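(* Suppose that $(R,B,L)$ is a Hadamard triple on $\mathbb{R}^d$ and let $\mu=\mu(R,B)$ be the associated self-affine measure. Let $\mathcal{Z}=\{\xi\in\mathbb{R}^d:\widehat\mu(\xi+k)=0\text{ for all }k\in\mathbb{Z}^d\}$. Then the following are equivalent: (1) $\mathcal{Z}=\emptyset$; (2) $\mu$ has a spectrum contained in $\mathbb{Z}^d$. In particular, if $\mathcal{Z}=\emptyset$, then $\mu$ is a spectral measure.
   Context: Hadamard triple: $R\in M_d(\mathbb{Z})$ is an expansive matrix (all eigenvalues have modulus $>1$), $B,L\subset\mathbb{Z}^d$ are finite sets with $\#B=\#L=:N$, and the matrix $\frac{1}{\sqrt N}\left[e^{2\pi i\langle R^{-1}b,\ell\rangle}\right]_{\ell\in L,b\in B}$ is unitary. Self-affine measure: with $\tau_b(x)=R^{-1}(x+b)$, $\mu(R,B)$ is the unique Borel probability measure on $\mathbb{R}^d$ with $\mu(E)=\frac1N\sum_{b\in B}\mu(\tau_b^{-1}(E))$ for all Borel $E$. Its Fourier transform is $\widehat\mu(\xi)=\int e^{-2\pi i\langle\xi,x\rangle}d\mu(x)$. A spectrum of $\mu$ is a countable set $\Lambda\subset\mathbb{R}^d$ such that $\{e^{2\pi i\langle\lambda,x\rangle}:\lambda\in\Lambda\}$ is an orthonormal basis of $L^2(\mu)$; $\mu$ is a spectral measure if it has a spectrum. *)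

(* Defs.v *)
From HB Require Import structures.
From mathcomp Require Import all_boot all_order all_algebra finmap.
From mathcomp Require Import spectral.
From mathcomp Require Import all_classical all_reals all_analysis.
From mathcomp Require Import complex.

Set Implicit Arguments.
Unset Strict Implicit.
Unset Printing Implicit Defensive.

Import Order.TTheory GRing.Theory Num.Theory.
Import numFieldNormedType.Exports.

Local Open Scope classical_set_scope.
Local Open Scope complex_scope.
Local Open Scope ring_scope.

(* K^d, as column vectors, with the Borel sigma-algebra (the one generated by
   the open sets). *)
Notation Kd K d := (g_sigma_algebraType (@open 'cV[K]_d)).

Definition dot (K : realType) (d : nat) (x y : 'cV[K]_d) : K :=
  \sum_(i < d) x i 0 * y i 0.

Definition intmx (K : realType) (m n : nat) (M : 'M[int]_(m, n)) :
  'M[K]_(m, n) := map_mx intr M.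
Arguments intmx K {m n} M.

Definition Zd (K : realType) (d : nat) : set 'cV[K]_d :=
  [set x | exists k : 'cV[int]_d, x = intmx K k].
Arguments Zd K d : clear implicits.

(* e^{i t} *)
Definition cis (K : realType) (t : K) : K[i] := cos t +i* sin t.

Definition echar (K : realType) (d : nat) (xi x : 'cV[K]_d) : K[i] :=
  cis (2 * pi * dot xi x).

Definition expansive (K : realType) (d : nat) (R : 'M[int]_d) : Prop :=
  forall a : K[i], eigenvalue (map_mx intr R : 'M[K[i]]_d) a -> 1 < `|a|.
Arguments expansive K {d} R.

(* The elements of L and B index the rows and columns through the enumerations
   of these finite sets. *)
Definition hadamard_mx (K : realType) (d : nat) (R : 'M[int]_d)
    (B L : {fset 'cV[int]_d}) : 'M[K[i]]_(#|` L|, #|` B|) :=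
  \matrix_(l, b) ((Num.sqrt (#|` B|%:R : K))^-1%:C *
    cis (2 * pi * dot (invmx (intmx K R) *m intmx K B`_b) (intmx K L`_l))).

(* The library's unitarymx M only says M M^* = 1, also for rectangular M; the
   matrix here is square because of the second condition. *)
Definition hadamard_triple (K : realType) (d : nat) (R : 'M[int]_d)
    (B L : {fset 'cV[int]_d}) : Prop :=
  [/\ expansive K R,
      #|` B| = #|` L| &
      hadamard_mx K R B L \is unitarymx].
Arguments hadamard_triple K {d} R B L.

Definition tau (K : realType) (d : nat) (R : 'M[int]_d) (b : 'cV[int]_d)
  (x : Kd K d) : Kd K d := invmx (intmx K R) *m (x + intmx K b).

(* This determines mu uniquely among Borel probability measures when R is
   expansive and B is not empty. *)
Definition self_affine (K : realType) (d : nat) (R : 'M[int]_d)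
    (B : {fset 'cV[int]_d}) (mu : probability (Kd K d) K) : Prop :=
  forall E : set (Kd K d), measurable E ->
    mu E = ((#|` B|%:R^-1)%:E *
            \sum_(b <- enum_fset B) mu (tau R b @^-1` E))%E.

Definition cintegral (disp : measure_display) (T : measurableType disp)
    (K : realType) (mu : {measure set T -> \bar K}) (f : T -> K[i]) : K[i] :=
  Rintegral mu setT (fun x => complex.Re (f x)) +i*
  Rintegral mu setT (fun x => complex.Im (f x)).

Definition fourier (K : realType) (d : nat) (mu : probability (Kd K d) K)
  (xi : 'cV[K]_d) : K[i] := cintegral mu (fun x => cis (- (2 * pi * dot xi x))).

Definition periodic_zeros (K : realType) (d : nat)
    (mu : probability (Kd K d) K) : set 'cV[K]_d :=
  [set xi | forall k : 'cV[int]_d, fourier mu (xi + intmx K k) = 0].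

Definition L2norm (disp : measure_display) (T : measurableType disp)
    (K : realType) (mu : {measure set T -> \bar K}) (f : T -> K[i]) : \bar K :=
  Lnorm mu 2%:E (fun x => (ComplexField.Normc.normc (f x))%:E).

(* Square-integrable functions, as representatives of their classes modulo
   almost everywhere equality *)
Definition inL2 (disp : measure_display) (T : measurableType disp)
    (K : realType) (mu : {measure set T -> \bar K}) (f : T -> K[i]) : Prop :=
  [/\ measurable_fun setT (fun x => complex.Re (f x)),
      measurable_fun setT (fun x => complex.Im (f x)) &
      (L2norm mu f < +oo)%E].

Definition inner (disp : measure_display) (T : measurableType disp)
    (K : realType) (mu : {measure set T -> \bar K}) (f g : T -> K[i]) : K[i] :=
  cintegral mu (fun x => f x * (g x)^*).

(* An orthonormal family in L^2(mu) with dense linear span *)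
Definition orthonormal_basis (disp : measure_display)
    (T : measurableType disp) (K : realType) (mu : {measure set T -> \bar K})
    (I : choiceType) (J : set I) (e : I -> T -> K[i]) : Prop :=
  [/\ forall j, J j -> inL2 mu (e j),
      forall j k, J j -> J k -> inner mu (e j) (e k) = (j == k)%:R &
      forall f, inL2 mu f -> forall eps : K, 0 < eps ->
        exists (s : seq I) (c : I -> K[i]), (forall j, j \in s -> J j) /\
          (L2norm mu (fun x => f x - \sum_(j <- s) c j * e j x)%R < eps%:E)%E].

Definition is_spectrum (K : realType) (d : nat) (mu : probability (Kd K d) K)
    (Lambda : set 'cV[K]_d) : Prop :=
  countable Lambda /\
  orthonormal_basis mu Lambda (fun lambda (x : Kd K d) => echar lambda x).

Definition spectral_measure (K : realType) (d : nat)
    (mu : probability (Kd K d) K) : Prop :=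
  exists Lambda : set 'cV[K]_d, is_spectrum mu Lambda.

(* Main.v *)
(** Write S for the inverse transpose of R and T for the transpose of R. The
    transform of mu satisfies mu^(xi) = m(xi) mu^(S xi), where m is
    (T Z^d)-periodic and, by the Hadamard condition, the |m(xi + l)|^2, l in L,
    sum to 1. Iterating, finite sets of frequencies of depth n are exactly
    orthonormal for the n-th finite product m(xi) m(S xi) .. m(S^(n-1) xi), and
    stay so when each frequency is moved by an element of T^n Z^d. If the
    periodic zero set is empty, compactness of the unit cube lets one choose
    these moves so that |mu^|^2 >= c > 0 at the rescaled frequencies, uniformly
    under small perturbations. A Tannery argument along a nested sequence of such
    sets shows that the Parseval sums of all exponentials tend to 1, and
    exponentials are dense in L^2(mu). Conversely, if xi is a periodic zero, the
    exponential of frequency -xi is orthogonal to all integer frequencies. *)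

Require Import Defs.
From mathcomp Require Import all_boot all_order all_algebra finmap.
From mathcomp Require Import spectral.
From mathcomp Require Import all_classical all_reals all_analysis.
From mathcomp Require Import measurable_realfun complex ring lra.

Set Implicit Arguments.
Unset Strict Implicit.
Unset Printing Implicit Defensive.

Import Order.TTheory GRing.Theory Num.Theory.
Import numFieldNormedType.Exports.
Import HBNNSimple.

Local Open Scope classical_set_scope.
Local Open Scope complex_scope.
Local Open Scope ring_scope.

(** The finite Parseval identities do not simply pass to the limit: the mass of the finite products
    may sit at frequencies where the transform of [mu] is small, and be lost. The bound [c] excludes
    this. It must hold with a margin [delta], because a rescaled frequency differs from the one that
    was controlled by the image of [xi] and by those of frequencies chosen at earlier levels, which
    are merely small. Frequency 0 belongs to every set and is never moved; this makes the sets
    nested.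

    Orthogonality passes to [mu] at once, since its transform is the finite product times another
    factor.

    The decay of the iterates of S comes from the eigenvalue condition through Cayley-Hamilton, not
    from a norm adapted to [R].

    Density of all exponentials goes through multipliers, the bounded functions that map their
    closed span into itself. Multipliers are visibly stable under products, which the closed span is
    not; so sines, their signs, half-spaces and finally all Borel sets are reached by algebra and
    bounded pointwise limits. *)

Section complex.
Context {K : realType}.
Implicit Types (z w : K[i]) (t : K).

(** * Squared modulus and the unit circle *)

Definition sqn z : K := complex.Re z ^+ 2 + complex.Im z ^+ 2.

Lemma sqn_ge0 z : 0 <= sqn z.
Proof. by rewrite addr_ge0 ?sqr_ge0. Qed.

Lemma sqnE z : sqn z = ComplexField.Normc.normc z ^+ 2.
Proof. by case: z => a b; rewrite /sqn /= sqr_sqrtr ?addr_ge0 ?sqr_ge0. Qed.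

Lemma sqnM z w : sqn (z * w) = sqn z * sqn w.
Proof. by case: z w => [a b] [c e]; rewrite /sqn /=; ring. Qed.

Lemma sqn0 : sqn 0 = 0.
Proof. by rewrite /sqn /= !expr0n /= addr0. Qed.

Lemma sqn1 : sqn 1 = 1.
Proof. by rewrite /sqn /= expr1n expr0n /= addr0. Qed.

Lemma sqnN z : sqn (- z) = sqn z.
Proof. by case: z => a b; rewrite /sqn /= !sqrrN. Qed.

Lemma sqn_eq0 z : sqn z = 0 -> z = 0.
Proof.
move=> /eqP; rewrite sqnE sqrf_eq0 => /eqP; exact: ComplexField.Normc.eq0_normc.
Qed.

Lemma mul_conj_sqn z : z * z^* = (sqn z)%:C.
Proof. by case: z => a b; rewrite /sqn /=; simpc; congr (_ +i* _); ring. Qed.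

Lemma sqnD_le z w : sqn (z + w) <= 2 * sqn z + 2 * sqn w.
Proof.
case: z w => [a b] [c e]; rewrite /sqn /=.
by have := sqr_ge0 (a - c); have := sqr_ge0 (b - e); nra.
Qed.

Lemma cis0 : cis 0 = 1 :> K[i].
Proof. by rewrite /cis cos0 sin0. Qed.

Lemma cisD s t : cis (s + t) = cis s * cis t.
Proof. by rewrite /cis cosD sinD; simpc; congr (_ +i* _); ring. Qed.

Lemma cisN t : cis (- t) = (cis t)^*.
Proof. by rewrite /cis cosN sinN. Qed.

Lemma sqn_cis t : sqn (cis t) = 1.
Proof. by rewrite /sqn /cis /= cos2Dsin2. Qed.

Lemma cis_2pi_int (n : int) : cis (2 * pi * n%:~R) = 1 :> K[i].
Proof.
have nat_case k : cis (2 * pi * k%:R) = 1 :> K[i].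
  elim: k => [|k IH]; first by rewrite mulr0 cis0.
  rewrite -[k.+1%:R]natr1 mulrDr cisD IH mul1r mulr1 mulr_natl.
  by rewrite /cis cos2pi mulr2n sinDpi sinpi oppr0.
case: n => n; first exact: nat_case.
by rewrite NegzE mulrNz mulrN cisN nat_case rmorph1.
Qed.

Lemma sqr_sin_le t : sin t ^+ 2 <= t ^+ 2.
Proof.
wlog t0 : t / 0 <= t.
  move=> h; have [t0|t0] := leP 0 t; first exact: h.
  by rewrite -[sin t ^+ 2]sqrrN -sinN -[t ^+ 2]sqrrN h // oppr_ge0 ltW.
have [|c _] := @MVT_segment K sin cos 0 t t0 (fun x _ => is_derive_sin x).
  exact/continuous_subspaceT/continuous_sin.
rewrite sin0 !subr0 => ->; rewrite exprMn ler_piMl ?sqr_ge0// -(cos2Dsin2 c) lerDl sqr_ge0.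
Qed.

(** The half-angle formula [|e^{it} - 1| = 2 |sin (t/2)|] reduces this to [|sin| <= |id|]. *)
Lemma sqn_cis_sub1 t : sqn (cis t - 1) <= t ^+ 2.
Proof.
have -> : sqn (cis t - 1) = (2 * sin (t / 2)) ^+ 2.
  rewrite {1}[t](_ : _ = t / 2 + t / 2); last by field.
  rewrite /sqn /cis /= cosD sinD; have := cos2Dsin2 (t / 2).
  move: (cos _) (sin _) => a b h.
  have h2 : a ^+ 2 = 1 - b ^+ 2 by lra.
  by rewrite subr0; ring: h2.
by rewrite exprMn (le_trans (ler_wpM2l _ (sqr_sin_le _)))// -exprMn mulrC divfK.
Qed.

Lemma sqn_cis_sub1_le4 t : sqn (cis t - 1) <= 4.
Proof.
by rewrite (le_trans (sqnD_le _ _))// sqnN sqn_cis sqn1; lra.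
Qed.

End complex.

(** * Null sequences under a perturbed contraction *)

Section contraction.
Context {K : realType}.

Definition null_seq (u : nat -> K) :=
  forall e : K, 0 < e -> exists N, forall n, (N <= n)%N -> `|u n| <= e.

Lemma null_seq_contraction (u e : nat -> K) (r : K) :
  0 <= r -> r < 1 -> (forall n, 0 <= u n) ->
  (forall n, u n.+1 <= r * u n + e n) -> null_seq e -> null_seq u.
Proof.
move=> r0 r1 u0 hu he eps eps0.
have h1r : 0 < 1 - r by rewrite subr_gt0.
(* This threshold makes [eps / 2] the fixed point of [x -> r * x + eps / 2 * (1 - r)], so past [N]
   only a geometric term is added to [eps / 2]. *)
have [N hN] := he (eps / 2 * (1 - r)) ltac:(by rewrite mulr_gt0 ?divr_gt0).
have bound k : u (N + k)%N <= r ^+ k * u N + eps / 2.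
  elim: k => [|k IH]; first by rewrite addn0 expr0 mul1r lerDl divr_ge0 // ltW.
  rewrite addnS (le_trans (hu _)) //.
  have h2 : r * u (N + k)%N <= r * (r ^+ k * u N + eps / 2) by rewrite ler_wpM2l.
  have h3 := hN (N + k)%N (leq_addr _ _); rewrite ler_norml in h3.
  case/andP: h3 => _ h3; rewrite exprS; lra.
have /cvgrPdist_le /(_ (eps / 2 / (1 + u N))) : (GRing.exp r : nat -> K) n @[n --> \oo] --> 0.
  by apply: cvg_expr; rewrite ger0_norm.
have uN : 0 < 1 + u N by rewrite ltr_wpDr.
rewrite divr_gt0 ?divr_gt0// => /(_ isT) [M _ hM].
exists (N + M)%N => n hn.
have hk : (M <= n - N)%N by rewrite leq_subRL // (leq_trans _ hn) // leq_addr.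
have := bound (n - N)%N; rewrite subnKC ?(leq_trans _ hn) ?leq_addr // => hb.
have := hM _ hk; rewrite /= sub0r normrN ger0_norm ?exprn_ge0// => hr.
rewrite ger0_norm//; apply: (le_trans hb).
have : r ^+ (n - N) * u N <= eps / 2.
  have : r ^+ (n - N) * u N <= r ^+ (n - N) * (1 + u N).
    by rewrite ler_wpM2l ?exprn_ge0// lerDr.
  move/le_trans; apply; rewrite -ler_pdivlMr//.
lra.
Qed.

End contraction.

(** * Iterates of the inverse transpose of an expansive matrix *)

Section linear_iteration.
Context {K : realType}.

Lemma iter_mulmx0 (F : comNzRingType) d (A : 'M[F]_d) n :
  iter n (mulmx A) (0 : 'cV[F]_d) = 0.
Proof. by elim: n => //= n ->; rewrite mulmx0. Qed.

Lemma iter_mulmxB (F : comNzRingType) d (A : 'M[F]_d) n (x y : 'cV[F]_d) :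
  iter n (mulmx A) (x - y) = iter n (mulmx A) x - iter n (mulmx A) y.
Proof. by elim: n => //= n ->; rewrite mulmxBr. Qed.

Lemma iter_mulmxD (F : comNzRingType) d (A : 'M[F]_d) n (x y : 'cV[F]_d) :
  iter n (mulmx A) (x + y) = iter n (mulmx A) x + iter n (mulmx A) y.
Proof. by elim: n => //= n ->; rewrite mulmxDr. Qed.

Lemma iter_mulmxZ (F : comNzRingType) d (A : 'M[F]_d) n (a : F) (x : 'cV[F]_d) :
  iter n (mulmx A) (a *: x) = a *: iter n (mulmx A) x.
Proof. by elim: n => //= n ->; rewrite scalemxAr. Qed.

(* The product of the commuting factors [A - a] annihilates [v]; peeling off
   one factor turns the iterates of [v] into a first order linear recurrence
   with ratio [a] and a perturbation that tends to 0. *)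
Lemma null_seq_iter_factors d (A : 'M[K[i]]_d) (s : seq K[i]) (v : 'cV_d) :
  (forall a, a \in s -> ComplexField.Normc.normc a < 1) ->
  foldl (fun w a => A *m w - a *: w) v s = 0 ->
  forall i, null_seq (fun n => ComplexField.Normc.normc (iter n (mulmx A) v i 0)).
Proof.
elim: s v => [|a s IH] v hs /=.
  move=> -> i e e0; exists 0%N => n _.
  by rewrite iter_mulmx0 mxE ComplexField.Normc.normc0 normr0 ltW.
move=> hv i.
have {}IH := IH (A *m v - a *: v) (fun b hb => hs b (@mem_behead _ (a :: s) b hb)) hv.
have nn (z : K[i]) : 0 <= ComplexField.Normc.normc z.
  by case: z => ? ?; rewrite sqrtr_ge0.
apply: (null_seq_contraction (r := ComplexField.Normc.normc a)) (IH i) => //.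
  by apply: hs; rewrite mem_head.
move=> n; rewrite -ComplexField.Normc.normcM iter_mulmxB iter_mulmxZ -iterSr.
set u := iter n.+1 _ _; set w := iter n _ _.
have -> : u i 0 = a * w i 0 + (u - a *: w) i 0.
  by move: u w => u w; rewrite !mxE; ring.
exact: le_normcD.
Qed.

Lemma horner_mx_factors (F : comNzRingType) d (A : 'M[F]_d.+1) (s : seq F) (v : 'cV_d.+1) :
  horner_mx A (\prod_(a <- s) ('X - a%:P)) *m v =
  foldl (fun w a => A *m w - a *: w) v s.
Proof.
elim: s v => [|a s IH] v; first by rewrite big_nil rmorph1 mul1mx.
rewrite big_cons mulrC rmorphM /= -mulmxE -mulmxA IH.
by rewrite rmorphB /= horner_mx_X horner_mx_C mulmxBl mul_scalar_mx.
Qed.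

End linear_iteration.

Lemma expansive_unitmx (K : realType) d (R : 'M[int]_d) :
  expansive K R -> intmx K R \in unitmx.
Proof.
move=> hR; have : (map_mx intr R : 'M[K[i]]_d) \in unitmx.
  apply: contraT => h.
  have /det0P[v v0 vR] : \det (map_mx intr R : 'M[K[i]]_d) == 0.
    by move: h; rewrite unitmxE unitfE negbK.
  have : eigenvalue (map_mx intr R : 'M[K[i]]_d) 0.
    by apply/eigenvalueP; exists v; rewrite ?scale0r.
  by move/hR; rewrite normr0 ltr10.
have -> : (map_mx intr R : 'M[K[i]]_d) = map_mx (real_complex K) (intmx K R).
  by apply/matrixP => i j; rewrite !mxE rmorph_int.
by rewrite map_unitmx.
Qed.

(** The matrix S of the overview: the adjoint of the linear part of [tau] with respect to [dot]. *)
Definition invT (K : realType) d (R : 'M[int]_d) : 'M[K]_d := (invmx (intmx K R))^T.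

Arguments invT K {d} R.

Lemma invT_mul (K : realType) d (R : 'M[int]_d) (k : 'cV[int]_d) :
  expansive K R -> invT K R *m intmx K (R^T *m k) = intmx K k.
Proof.
move=> hR; rewrite /invT /intmx map_mxM -map_trmx mulmxA -trmx_mul.
by rewrite mulmxV ?expansive_unitmx// trmx1 mul1mx.
Qed.

(** The eigenvalues of S are inverses of those of [R], hence of modulus less than 1. Over [K[i]] the
    characteristic polynomial splits, and by Cayley-Hamilton its linear factors annihilate every
    vector, as [null_seq_iter_factors] requires. *)
Lemma null_seq_iter_invT (K : realType) d (R : 'M[int]_d) (x : 'cV[K]_d) i :
  expansive K R -> null_seq (fun n => iter n (mulmx (invT K R)) x i 0).
Proof.
rewrite /invT; case: d R x i => [|d'] R' x i hR'; first by case: i.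
pose A : 'M[K[i]]_d'.+1 := map_mx (real_complex K) (invmx (intmx K R'))^T.
pose RC : 'M[K[i]]_d'.+1 := map_mx intr R'.
have RCE : RC = map_mx (real_complex K) (intmx K R').
  by apply/matrixP => a b; rewrite !mxE rmorph_int.
have AE : A = (invmx RC)^T.
  by rewrite /A RCE -map_trmx map_invmx.
have uRC : RC \in unitmx by rewrite RCE map_unitmx expansive_unitmx.
have [s cs] := closed_field_poly_normal (char_poly A).
have := @null_seq_iter_factors K d'.+1 A s (map_mx (real_complex K) x).
have nA : forall a, a \in s -> ComplexField.Normc.normc a < 1.
  move=> a as_.
  (* [eigenvalue] is about row vectors. Passing to the transpose, which has the same characteristic
     polynomial, gives a row [v] with [v R^-1 = a v], hence [v R = a^-1 v]. *)
  have : eigenvalue A^T a.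
    rewrite eigenvalue_root_char.
    have -> : char_poly A^T = char_poly A.
      rewrite /char_poly -det_tr; congr (\det _).
      by apply/matrixP => p q; rewrite !mxE eq_sym.
    rewrite cs (monicP (char_poly_monic A)) scale1r root_prod_XsubC //.
  rewrite AE trmxK => /eigenvalueP[v vA v0].
  have va : v = a *: (v *m RC) by rewrite scalemxAl -vA mulmxKV.
  have a0 : a != 0 by apply: contra_neq v0 => a0; rewrite va a0 scale0r.
  have : eigenvalue RC a^-1.
    apply/eigenvalueP; exists v => //.
    by rewrite {2}va scalerA mulVf// scale1r.
  move/hR'; rewrite normfV invf_gt1 ?normr_gt0//.
  by rewrite -ltcR; case: (a).
move=> /(_ nA); rewrite -horner_mx_factors.
have -> : \prod_(a <- s) ('X - a%:P) = char_poly A.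
  by rewrite cs (monicP (char_poly_monic A)) scale1r.
rewrite Cayley_Hamilton mul0mx => /(_ erefl i) h e e0.
have [N hN] := h e e0; exists N => n /hN.
suff -> : iter n (mulmx A) (map_mx (real_complex K) x) =
  map_mx (real_complex K) (iter n (mulmx (invmx (intmx K R'))^T) x).
  by rewrite mxE /= expr0n addr0 sqrtr_sqr normr_id.
by elim: n => //= n ->; rewrite map_mxM.
Qed.

(** * Integration of bounded functions and the squared L2 norm *)

Section bounded_integration.
Context {disp : measure_display} {T : measurableType disp} {K : realType}.
Variable mu : probability T K.
Implicit Types (h : T -> K) (f g : T -> K[i]).

(** For a probability these functions are all integrable and they form an algebra, so the side
    conditions of linearity are discharged by closure lemmas. *)
Definition bdd_meas h := measurable_fun setT h /\ exists M, forall x, `|h x| <= M.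

Lemma bdd_meas_integrable h : bdd_meas h -> mu.-integrable setT (EFin \o h).
Proof.
move=> [mh [M hM]]; apply: measurable_bounded_integrable => //.
  exact: le_lt_trans (probability_le1 mu measurableT) (ltry _).
exists M; split; first exact: num_real.
by move=> y My x _; apply: le_trans (hM x) (ltW My).
Qed.

Lemma bdd_meas_cst (a : K) : bdd_meas (fun=> a).
Proof. by split; [exact: measurable_cst|exists `|a|]. Qed.

Lemma Rintegral_prob_cst (a : K) : Rintegral mu setT (fun=> a) = a.
Proof.
rewrite Rintegral_cst// -[RHS]mulr1; congr (_ * _).
by rewrite -[1]/(fine 1%:E); congr fine; exact: probability_setT.
Qed.

Lemma bdd_measD h1 h2 : bdd_meas h1 -> bdd_meas h2 -> bdd_meas (fun x => h1 x + h2 x).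
Proof.
move=> [m1 [M1 b1]] [m2 [M2 b2]]; split; first exact: measurable_funD.
by exists (M1 + M2) => x; rewrite (le_trans (ler_normD _ _))// lerD.
Qed.

Lemma bdd_measN h : bdd_meas h -> bdd_meas (fun x => - h x).
Proof.
move=> [m1 [M1 b1]]; split; first exact: measurableT_comp.
by exists M1 => x; rewrite normrN.
Qed.

Lemma bdd_measM h1 h2 : bdd_meas h1 -> bdd_meas h2 -> bdd_meas (fun x => h1 x * h2 x).
Proof.
move=> [m1 [M1 b1]] [m2 [M2 b2]]; split; first exact: measurable_funM.
by exists (M1 * M2) => x; rewrite normrM ler_pM.
Qed.

Lemma bdd_measB h1 h2 : bdd_meas h1 -> bdd_meas h2 -> bdd_meas (fun x => h1 x - h2 x).
Proof. by move=> b1 b2; exact: bdd_measD b1 (bdd_measN b2). Qed.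

Definition measC f := measurable_fun setT (fun x => complex.Re (f x)) /\
  measurable_fun setT (fun x => complex.Im (f x)).

Definition bdd_measC f := bdd_meas (fun x => complex.Re (f x)) /\ bdd_meas (fun x => complex.Im (f x)).

Lemma bdd_measC_measC f : bdd_measC f -> measC f.
Proof. by case=> -[? _] [? _]. Qed.

Lemma bdd_measC_cst (a : K[i]) : bdd_measC (fun=> a).
Proof. by split; exact: bdd_meas_cst. Qed.

Lemma ReD (z w : K[i]) : complex.Re (z + w) = complex.Re z + complex.Re w.
Proof. by case: z w => ? ? [? ?]. Qed.
Lemma ImD (z w : K[i]) : complex.Im (z + w) = complex.Im z + complex.Im w.
Proof. by case: z w => ? ? [? ?]. Qed.
Lemma ReM (z w : K[i]) :
  complex.Re (z * w) = complex.Re z * complex.Re w - complex.Im z * complex.Im w.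
Proof. by case: z w => ? ? [? ?]. Qed.
Lemma ImM (z w : K[i]) :
  complex.Im (z * w) = complex.Re z * complex.Im w + complex.Im z * complex.Re w.
Proof. by case: z w => ? ? [? ?]. Qed.
Lemma ReJ (z : K[i]) : complex.Re z^* = complex.Re z. Proof. by case: z. Qed.
Lemma ImJ (z : K[i]) : complex.Im z^* = - complex.Im z. Proof. by case: z. Qed.

Lemma bdd_measCD f g : bdd_measC f -> bdd_measC g -> bdd_measC (fun x => f x + g x).
Proof.
move=> [a b] [c e]; split.
  by under eq_fun do rewrite ReD; exact: bdd_measD.
by under eq_fun do rewrite ImD; exact: bdd_measD.
Qed.

Lemma bdd_measCM f g : bdd_measC f -> bdd_measC g -> bdd_measC (fun x => f x * g x).
Proof.
move=> [a b] [c e]; split.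
  by under eq_fun do rewrite ReM; apply: bdd_measB; exact: bdd_measM.
by under eq_fun do rewrite ImM; apply: bdd_measD; exact: bdd_measM.
Qed.

Lemma bdd_measCJ f : bdd_measC f -> bdd_measC (fun x => (f x)^*).
Proof.
move=> [a b]; split; first by under eq_fun do rewrite ReJ.
by under eq_fun do rewrite ImJ; exact: bdd_measN.
Qed.

Lemma bdd_measCN f : bdd_measC f -> bdd_measC (fun x => - f x).
Proof.
by move=> bf; under eq_fun do rewrite -mulN1r; exact: bdd_measCM (bdd_measC_cst _) bf.
Qed.

Lemma bdd_measC_sum (I : Type) (s : seq I) (F : I -> T -> K[i]) :
  (forall i, bdd_measC (F i)) -> bdd_measC (fun x => \sum_(i <- s) F i x).
Proof.
move=> hF; elim: s => [|i s IH].
  by under eq_fun do rewrite big_nil; exact: bdd_measC_cst.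
by under eq_fun do rewrite big_cons; exact: bdd_measCD.
Qed.

Lemma measCD f g : measC f -> measC g -> measC (fun x => f x + g x).
Proof.
move=> [a b] [c e]; split.
  by under eq_fun do rewrite ReD; exact: measurable_funD.
by under eq_fun do rewrite ImD; exact: measurable_funD.
Qed.

Lemma measCM f g : measC f -> measC g -> measC (fun x => f x * g x).
Proof.
move=> [a b] [c e]; split.
  by under eq_fun do rewrite ReM; apply: measurable_funB; exact: measurable_funM.
by under eq_fun do rewrite ImM; apply: measurable_funD; exact: measurable_funM.
Qed.

Lemma measCB f g : measC f -> measC g -> measC (fun x => f x - g x).
Proof.
move=> mf mg; apply: measCD mf _; under eq_fun do rewrite -mulN1r.
by apply: measCM => //; apply/bdd_measC_measC/bdd_measC_cst.
Qed.

Lemma measurable_sqn f : measC f -> measurable_fun setT (fun x => sqn (f x)).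
Proof.
move=> [a b]; rewrite /sqn; under eq_fun do rewrite !expr2.
by apply: measurable_funD; exact: measurable_funM.
Qed.

Lemma bdd_meas_sqn f : bdd_measC f -> bdd_meas (fun x => sqn (f x)).
Proof.
move=> [a b]; rewrite /sqn; under eq_fun do rewrite !expr2.
by apply: bdd_measD; exact: bdd_measM.
Qed.

Lemma eq_cintegral f g : f =1 g -> cintegral mu f = cintegral mu g.
Proof. by move=> /funext ->. Qed.

Lemma cintegral_cst (a : K[i]) : cintegral mu (fun=> a) = a.
Proof.
by rewrite /cintegral !Rintegral_prob_cst; case: a.
Qed.

Lemma cintegralD f g : bdd_measC f -> bdd_measC g ->
  cintegral mu (fun x => f x + g x) = cintegral mu f + cintegral mu g.
Proof.
move=> [a b] [c e]; rewrite /cintegral.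
under [X in X +i* _]eq_Rintegral do rewrite ReD.
under [X in _ +i* X]eq_Rintegral do rewrite ImD.
by rewrite !RintegralD//; apply: bdd_meas_integrable.
Qed.

Lemma cintegralM (a : K[i]) f : bdd_measC f ->
  cintegral mu (fun x => a * f x) = a * cintegral mu f.
Proof.
move=> [b c]; rewrite /cintegral; case: a => p q.
have bp (r : K) h : bdd_meas h -> mu.-integrable setT (EFin \o (fun x => r * h x)).
  by move=> bh; apply/bdd_meas_integrable/bdd_measM => //; exact: bdd_meas_cst.
under [X in X +i* _]eq_Rintegral do rewrite ReM.
under [X in _ +i* X]eq_Rintegral do rewrite ImM.
rewrite RintegralB ?RintegralD ?RintegralZl//=; do ?[exact: bp|exact: bdd_meas_integrable].
Qed.

Lemma cintegralJ f : bdd_measC f ->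
  cintegral mu (fun x => (f x)^*) = (cintegral mu f)^*.
Proof.
move=> [b c]; rewrite /cintegral.
under [X in X +i* _]eq_Rintegral do rewrite ReJ.
under [X in _ +i* X]eq_Rintegral do rewrite ImJ -mulN1r.
rewrite RintegralZl// ?mulN1r//; exact: bdd_meas_integrable.
Qed.

Lemma cintegralB f g : bdd_measC f -> bdd_measC g ->
  cintegral mu (fun x => f x - g x) = cintegral mu f - cintegral mu g.
Proof.
move=> bf bg; rewrite -mulN1r -cintegralM// -cintegralD//.
  by apply: eq_cintegral => x; rewrite mulN1r.
by apply: bdd_measCM => //; exact: bdd_measC_cst.
Qed.

Lemma cintegral_sum (I : Type) (s : seq I) (F : I -> T -> K[i]) :
  (forall i, bdd_measC (F i)) ->
  cintegral mu (fun x => \sum_(i <- s) F i x) = \sum_(i <- s) cintegral mu (F i).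
Proof.
move=> hF; elim: s => [|i s IH].
  rewrite big_nil -[RHS](cintegral_cst 0); apply: eq_cintegral => x.
  by rewrite big_nil.
rewrite big_cons -IH -cintegralD//; last exact: bdd_measC_sum.
by apply: eq_cintegral => x; rewrite big_cons.
Qed.

(** The variance is nonnegative: with [m] the mean, the integrand of the first claim is
    [(h x - m) ^+ 2]. *)
Lemma sqr_Rintegral_le h : bdd_meas h ->
  (Rintegral mu setT h) ^+ 2 <= Rintegral mu setT (fun x => h x ^+ 2).
Proof.
move=> bh; set m := Rintegral _ _ _.
have b2 : bdd_meas (fun x => h x ^+ 2).
  by under eq_fun do rewrite expr2; exact: bdd_measM.
have : 0 <= Rintegral mu setT (fun x => h x ^+ 2 - (2 * m * h x - m ^+ 2)).
  by apply: Rintegral_ge0 => x _; have := sqr_ge0 (h x - m); nra.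
have b1 : bdd_meas (fun x => 2 * m * h x) by apply: bdd_measM => //; exact: bdd_meas_cst.
rewrite RintegralB//; do ?apply: bdd_meas_integrable => //; last first.
  by apply: bdd_measB => //; exact: bdd_meas_cst.
rewrite RintegralB//; do ?apply: bdd_meas_integrable => //; last exact: bdd_meas_cst.
rewrite RintegralZl//; last exact: bdd_meas_integrable.
rewrite Rintegral_prob_cst -/m; nra.
Qed.

Lemma sqn_cintegral_le f : bdd_measC f ->
  sqn (cintegral mu f) <= Rintegral mu setT (fun x => sqn (f x)).
Proof.
move=> [b c]; rewrite RintegralD//.
- by rewrite /sqn /= lerD// sqr_Rintegral_le.
- by apply: bdd_meas_integrable; under eq_fun do rewrite expr2; exact: bdd_measM.
- by apply: bdd_meas_integrable; under eq_fun do rewrite expr2; exact: bdd_measM.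
Qed.

Lemma innerE f : bdd_measC f -> inner mu f f = (Rintegral mu setT (fun x => sqn (f x)))%:C.
Proof.
move=> bf; rewrite /inner /cintegral.
under [X in X +i* _]eq_Rintegral do rewrite mul_conj_sqn.
under [X in _ +i* X]eq_Rintegral do rewrite mul_conj_sqn.
by rewrite /= Rintegral_prob_cst.
Qed.

(** The square of [L2norm], kept in the extended reals so that unbounded functions are allowed.
    Estimates are made here without roots; [L2norm_lt] and [L2norm_fin] translate back. *)
Definition L2sq f : \bar K := \int[mu]_x (sqn (f x))%:E.

Lemma L2sqE f : bdd_measC f -> L2sq f = (Rintegral mu setT (fun x => sqn (f x)))%:E.
Proof.
move=> /bdd_meas_sqn/bdd_meas_integrable h; rewrite /Rintegral fineK//.
exact: integrable_fin_num.
Qed.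

Lemma L2sq_ge0 f : (0 <= L2sq f)%E.
Proof. by apply: integral_ge0 => x _; rewrite lee_fin sqn_ge0. Qed.

Lemma L2normE f : L2norm mu f = ((L2sq f) `^ 2^-1)%E.
Proof.
rewrite /L2norm unlock /L2sq; congr (_ `^ _)%E; apply: eq_integral => x _.
have n0 (z : K[i]) : 0 <= ComplexField.Normc.normc z.
  by case: z => ? ?; rewrite sqrtr_ge0.
by rewrite abse_EFin ger0_norm// poweR_EFin powR_mulrn// sqnE.
Qed.

Lemma L2norm_lt f (e : K) : 0 < e -> (L2norm mu f < e%:E)%E <-> (L2sq f < (e ^+ 2)%:E)%E.
Proof.
move=> e0; rewrite L2normE; have := L2sq_ge0 f; case: (L2sq f) => [r| |] //.
- rewrite lee_fin => r0; rewrite poweR_EFin !lte_fin.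
  have -> : e = (e ^+ 2) `^ 2^-1.
    by rewrite -powR_mulrn ?ltW// -powRrM divff// powRr1// ltW.
  rewrite -[(_ `^ _) ^+ 2]powR_mulrn ?powR_ge0// -powRrM mulVf// powRr1 ?sqr_ge0//.
  split=> [h|h]; last by rewrite gt0_ltr_powR// ?nnegrE ?sqr_ge0// invr_gt0.
  rewrite ltNge; apply/negP => h'; move: h; rewrite ltNge => /negP; apply.
  by rewrite ge0_ler_powR// ?nnegrE ?sqr_ge0// invr_ge0.
- by rewrite poweRyr// ltNge leey /=; split => //; rewrite ltNge leey.
Qed.

Lemma L2norm_fin f : (L2norm mu f < +oo)%E <-> (L2sq f < +oo)%E.
Proof.
rewrite L2normE; have := L2sq_ge0 f; case: (L2sq f) => [r| |] //.
- by rewrite poweR_EFin !ltry.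
- by rewrite poweRyr.
Qed.

Lemma L2sqD f g : measC f -> measC g ->
  (L2sq (fun x => f x + g x)%R <= 2%:E * L2sq f + 2%:E * L2sq g)%E.
Proof.
move=> mf mg; have m (h : T -> K[i]) (mh : measC h) := measurable_sqn mh.
rewrite /L2sq -!ge0_integralZl_EFin//; do ?[by move=> x _; rewrite lee_fin sqn_ge0].
- rewrite -ge0_integralD//.
  + apply: ge0_le_integral => //.
    * by move=> x _; rewrite lee_fin sqn_ge0.
    * by apply/measurable_EFinP/measurable_sqn/measCD.
    * by apply: emeasurable_funD; apply: measurable_funeM; apply/measurable_EFinP; exact: m.
    * by move=> x _; rewrite -!EFinM -EFinD lee_fin sqnD_le.
  + by move=> x _; rewrite -EFinM lee_fin mulr_ge0// sqn_ge0.
  + by apply: measurable_funeM; apply/measurable_EFinP; exact: m.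
  + by move=> x _; rewrite -EFinM lee_fin mulr_ge0// sqn_ge0.
  + by apply: measurable_funeM; apply/measurable_EFinP; exact: m.
- by apply/measurable_EFinP/m.
- by apply/measurable_EFinP/m.
Qed.

Lemma L2sqZ (a : K[i]) f : measC f -> L2sq (fun x => a * f x)%R = ((sqn a)%:E * L2sq f)%E.
Proof.
move=> mf; rewrite /L2sq; under eq_integral do rewrite sqnM EFinM.
rewrite ge0_integralZl_EFin ?sqn_ge0//; last by apply/measurable_EFinP/measurable_sqn.
by move=> x _; rewrite lee_fin sqn_ge0.
Qed.

End bounded_integration.

(** * Borel sets of [K^d], the pairing and the exponentials *)

Section borel.
Context {K : realType} {d : nat}.

(** An open set is a countable union of rational boxes, and a box is a finite intersection of
    half-spaces and complements of half-spaces. The family [G] is arbitrary because the lemma serves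
    twice: for measurability of maps into [Kd K d], and for the sets whose indicators are
    multipliers. *)
Lemma sigma_algebra_open (G : set (set 'cV[K]_d)) :
  sigma_algebra setT G ->
  (forall i (a : K), G [set x : 'cV[K]_d | a < x i 0]) ->
  @open 'cV[K]_d `<=` G.
Proof.
move=> [G0 GC GU] Gh U oU.
have GT : G setT by rewrite -(setD0 setT); exact: GC.
have Gc A : G A -> G (~` A) by move=> /GC; rewrite setTD.
have GU2 A B : G A -> G B -> G (A `|` B).
  move=> GA GB; rewrite -bigcup2E; apply: GU => n.
  by rewrite /bigcup2; case: n => [|[|n]].
have GI A B : G A -> G B -> G (A `&` B).
  by move=> GA GB; rewrite -[A]setCK -[B]setCK -setCU; apply/Gc/GU2; exact: Gc.
(* Boxes are closed above because the upper condition is the complement of an open half-space. *)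
pose box (p : 'cV[rat]_d * rat) : set 'cV[K]_d :=
  [set y | forall i, ratr (p.1 i 0 - p.2) < y i 0 /\ y i 0 <= ratr (p.1 i 0 + p.2)].
have Gbox p : G (box p).
  have -> : box p = \big[setI/setT]_(i <- enum 'I_d)
      ([set y | ratr (p.1 i 0 - p.2) < y i 0] `&`
       ~` [set y | ratr (p.1 i 0 + p.2) < y i 0]).
    rewrite -bigcap_seq; apply/seteqP; split=> y /= h.
      by move=> i _; have [h1 h2] := h i; split=> //=; apply/negP; rewrite -leNgt.
    move=> i; have [|h1 /= /negP] := h i; first by rewrite /= mem_enum.
    by rewrite -leNgt.
  elim: (enum 'I_d) => [|i s IH]; first by rewrite big_nil.
  by rewrite big_cons; apply: (GI _ _ _ IH); apply: GI; [|apply: Gc]; exact: Gh.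
(* The countable type of boxes is enumerated by [unpickle]; codes of no box, or of a box not inside
   [U], contribute the empty set. *)
pose F n := if @choice.unpickle ('cV[rat]_d * rat)%type n is Some p then
  (if `[< box p `<=` U >] then box p else set0) else set0.
have -> : U = \bigcup_n F n.
  apply/seteqP; split=> [x Ux|x [n _]]; last first.
    by rewrite /F; case: choice.unpickle => // p; case: asboolP => // h /h.
  move: (oU); rewrite openE => /(_ _ Ux); rewrite /interior -nbhs_ballE.
  move=> -[e /= e0 xU].
  (* A centre within [r] of [x] and a box of radius [r] stay within [2 r < e] of [x]. *)
  have [r /andP[r0 re]] : exists r : rat, 0 < (ratr r : K) < e / 2.
    have e2 : 0 < e / 2 by rewrite divr_gt0.
    by have [r] := rat_in_itvoo e2; rewrite in_itv /= => h; exists r.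
  have /choice[q hq] (i : 'I_d) : exists q : rat, x i 0 - ratr r < (ratr q : K) < x i 0 + ratr r.
    have : x i 0 - ratr r < x i 0 + ratr r :> K by lra.
    by move/rat_in_itvoo => [s]; rewrite in_itv /= => h; exists s.
  exists (choice.pickle (\col_i q i, r)) => //.
  rewrite /F choice.pickleK; case: asboolP => /= [_ i|[]].
    by rewrite mxE rmorphB rmorphD /=; have /andP[] := hq i; split; lra.
  move=> y hy; apply: xU; split=> // i j; rewrite (ord1 j).
  have [] := hy i; rewrite /= mxE rmorphB rmorphD /= => h1 h2.
  have /andP[h3 h4] := hq i.
  by rewrite /ball /= ltr_norml; lra.
by apply: GU => n; rewrite /F; case: choice.unpickle => // p; case: ifP.
Qed.

Lemma measurable_coord i : measurable_fun setT (fun x : Kd K d => x i 0).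
Proof.
apply: (measurability _ (RGenOInfty.measurableE K)) => _ [_ [a ->] <-].
rewrite setTI; apply: sub_sigma_algebra.
have -> : (fun x : Kd K d => x i 0) @^-1` `]a, +oo[%classic =
    (fun x : 'cV[K]_d => x i 0) @^-1` [set y | a < y].
  by apply/seteqP; split=> x /=; rewrite in_itv /= andbT.
apply: open_comp; last exact: open_gt.
by move=> x _; exact: coord_continuous.
Qed.

Lemma measurable_fun_Kd disp (T : measurableType disp) (f : T -> Kd K d) :
  (forall i, measurable_fun setT (fun x => f x i 0)) -> measurable_fun setT f.
Proof.
move=> mf; apply: (@measurability _ _ _ (Kd K d) setT f (@open 'cV[K]_d) erefl) => _ [U oU <-].
rewrite setTI.
apply: (@sigma_algebra_open [set A | measurable (f @^-1` A)]) => //=.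
  split=> /=.
  - by rewrite preimage_set0.
  - by move=> A mA; rewrite setTD preimage_setC; exact: measurableC.
  - by move=> A mA; rewrite preimage_bigcup; exact: bigcup_measurable.
move=> i a; have := mf i measurableT _ (measurable_itv `]a, +oo[).
rewrite setTI; congr measurable.
by apply/seteqP; split=> x /=; rewrite in_itv /= andbT.
Qed.

Lemma measurable_dot xi : measurable_fun setT (fun x : Kd K d => dot xi x).
Proof.
apply: measurable_sum => i; apply: measurable_funM => //.
exact: measurable_coord.
Qed.

Lemma dotDl (x y z : 'cV[K]_d) : dot (x + y) z = dot x z + dot y z.
Proof. by rewrite -big_split; apply: eq_bigr => i _; rewrite mxE mulrDl. Qed.

Lemma dotDr (x y z : 'cV[K]_d) : dot z (x + y) = dot z x + dot z y.
Proof. by rewrite -big_split; apply: eq_bigr => i _; rewrite mxE mulrDr. Qed.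

Lemma dotC (x y : 'cV[K]_d) : dot x y = dot y x.
Proof. by apply: eq_bigr => i _; rewrite mulrC. Qed.

Lemma dotNl (x z : 'cV[K]_d) : dot (- x) z = - dot x z.
Proof. by rewrite -sumrN; apply: eq_bigr => i _; rewrite mxE mulNr. Qed.

Lemma dot0l (z : 'cV[K]_d) : dot 0 z = 0.
Proof. by rewrite /dot big1// => i _; rewrite mxE mul0r. Qed.

Lemma dotE (x y : 'cV[K]_d) : dot x y = (x^T *m y) 0 0.
Proof. by rewrite mxE; apply: eq_bigr => i _; rewrite mxE. Qed.

Lemma dot_mulmx (A : 'M[K]_d) (x y : 'cV[K]_d) : dot (A *m x) y = dot x (A^T *m y).
Proof. by rewrite !dotE trmx_mul mulmxA. Qed.

Lemma dot_int (k l : 'cV[int]_d) :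
  dot (intmx K k) (intmx K l) = (\sum_i k i 0 * l i 0)%:~R.
Proof. by rewrite rmorph_sum; apply: eq_bigr => i _; rewrite !mxE rmorphM. Qed.

Lemma cis_2pi_dot_int (k l : 'cV[int]_d) :
  cis (2 * pi * dot (intmx K k) (intmx K l)) = 1.
Proof. by rewrite dot_int cis_2pi_int. Qed.

Lemma intmxD (k l : 'cV[int]_d) : intmx K (k + l) = intmx K k + intmx K l.
Proof. exact: map_mxD. Qed.

Lemma intmxN (k : 'cV[int]_d) : intmx K (- k) = - intmx K k.
Proof. exact: map_mxN. Qed.

Lemma intmx0 : intmx K (0 : 'cV[int]_d) = 0.
Proof. exact: map_mx0. Qed.

Lemma intmx_inj : injective (fun k : 'cV[int]_d => intmx K k).
Proof.
move=> k l /matrixP kl; apply/matrixP => i j.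
by have := kl i j; rewrite !mxE => /intr_inj.
Qed.

Lemma echarD (a b x : 'cV[K]_d) : echar (a + b) x = echar a x * echar b x.
Proof. by rewrite /echar dotDl mulrDr cisD. Qed.

Lemma echarN (a x : 'cV[K]_d) : echar (- a) x = (echar a x)^*.
Proof. by rewrite /echar dotNl mulrN cisN. Qed.

Lemma bdd_measC_echar (a : 'cV[K]_d) : bdd_measC (fun x : Kd K d => echar a x).
Proof.
have m : measurable_fun setT (fun x : Kd K d => 2 * pi * dot a x).
  by apply: measurable_funM => //; exact: measurable_dot.
split; split; rewrite /echar /cis /=.
- exact: measurableT_comp (continuous_measurable_fun (@continuous_cos K)) m.
- by exists 1 => x; exact: cos_max.
- exact: measurableT_comp (continuous_measurable_fun (@continuous_sin K)) m.
- by exists 1 => x; exact: sin_max.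
Qed.

End borel.

(** Dominated convergence to 0 with explicit thresholds, used both for the continuity of the
    transform and for limits of multipliers. *)
Lemma dominated_null disp (T : measurableType disp) (K : realType)
    (mu : {measure set T -> \bar K}) (h : nat -> T -> K) (g : T -> K) :
  (forall n, measurable_fun setT (h n)) ->
  (forall n t, 0 <= h n t) -> (forall n t, h n t <= g t) ->
  mu.-integrable setT (EFin \o g) ->
  (forall t, null_seq (h ^~ t)) ->
  forall e : K, 0 < e -> exists N, forall n, (N <= n)%N ->
    (\int[mu]_t (h n t)%:E < e%:E)%E.
Proof.
move=> mh h0 hg ig hnull e e0.
have mhE n : measurable_fun setT (fun t => (h n t)%:E) by exact/measurable_EFinP.
have cv : {ae mu, forall t, setT t -> (h n t)%:E @[n --> \oo] --> (cst 0%E t : \bar K)}.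
  apply: aeW => t _ /=; apply/(fine_cvgP (fun n => (h n t)%:E) 0%R); split; first exact: nearW.
  apply/cvgrPdist_le => eps /(hnull t)[N hN].
  by exists N => // n /hN /=; rewrite sub0r normrN.
have dom : {ae mu, forall t n, setT t -> (`|(h n t)%:E| <= (EFin \o g) t)%E}.
  by apply: aeW => t n _; rewrite lee_fin ger0_norm.
have [_ _] := dominated_convergence measurableT mhE (measurable_cst 0%E) cv ig dom.
rewrite integral0.
move=> /(fine_cvgP (fun n => (\int[mu]_t (h n t)%:E)%E) 0%R)[fin /cvgrPdist_lt /(_ e e0) lim].
have [N _ hN] := filterI fin lim.
exists N => n /hN[/=]; rewrite sub0r normrN => fn.
by rewrite -[X in (X < _)%E]fineK// lte_fin; exact: le_lt_trans (ler_norm _).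
Qed.

(** * The Fourier transform and its uniform continuity *)

Section fourier.
Context {K : realType} {d : nat}.
Variable mu : probability (Kd K d) K.

Lemma fourierE xi : fourier mu xi = cintegral mu (fun x => echar (- xi) x).
Proof. by apply: eq_cintegral => x; rewrite /echar dotNl mulrN. Qed.

Lemma inner_echar a b :
  inner mu (fun x : Kd K d => echar a x) (fun x => echar b x) = fourier mu (b - a).
Proof.
by rewrite fourierE; apply: eq_cintegral => x; rewrite -echarN -echarD opprB.
Qed.

Lemma fourier0 : fourier mu 0 = 1.
Proof.
rewrite -[RHS](cintegral_cst mu); apply: eq_cintegral => x.
by rewrite dot0l mulr0 oppr0 cis0.
Qed.

Lemma sqn_fourier_le1 xi : sqn (fourier mu xi) <= 1.
Proof.
rewrite fourierE (le_trans (sqn_cintegral_le _ (bdd_measC_echar _)))//.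
under eq_Rintegral do rewrite sqn_cis.
by rewrite Rintegral_prob_cst.
Qed.

(** The increment is the integral of [echar (- x) t * (echar (- y) t - 1)], whose modulus does not
    depend on [x]; hence the uniformity. When all coordinates of [y] are at most [1/(n+1)], its
    square is at most [h n], which tends to 0 pointwise. The cap 4 in [h] is the dominating
    constant, since [n1] is unbounded. *)
Lemma fourier_unif (e : K) : 0 < e -> exists2 delta : K, 0 < delta &
  forall y : 'cV[K]_d, (forall i, `|y i 0| <= delta) ->
  forall x, sqn (fourier mu (x + y) - fourier mu x) <= e.
Proof.
move=> e0.
pose n1 (t : Kd K d) := 2 * pi * \sum_(i < d) `|t i 0|.
have mn1 : measurable_fun setT n1.
  apply: measurable_funM => //; apply: measurable_sum => i.
  by apply: measurableT_comp => //; exact: measurable_coord.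
pose h n (t : Kd K d) : K := Num.min 4 ((n.+1%:R^-1 * n1 t) ^+ 2).
have h0 n t : 0 <= h n t by rewrite /h le_min sqr_ge0 andbT.
have h4 n t : h n t <= 4 by rewrite /h ge_min lexx.
have mh n : measurable_fun setT (h n).
  apply: measurable_minr => //; apply: measurable_funX.
  exact: measurable_funM.
have bh n : bdd_meas (h n).
  by split => //; exists 4 => t; rewrite ger0_norm.
have hnull t : null_seq (h ^~ t).
  have n0 : 0 <= n1 t by rewrite mulr_ge0 ?mulr_ge0 ?pi_ge0// sumr_ge0.
  move=> eps eps0.
  (* For [v = n1 t / (n+1)] at most 1 and at most [eps], also [v ^+ 2 <= v <= eps]. The denominator
     [1 + n1 t] covers [n1 t = 0]. *)
  have q0 : 0 < Num.min 1 eps / (1 + n1 t).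
    by rewrite divr_gt0 ?lt_min ?ltr01// ltr_wpDr.
  have [N _ hN] := near_infty_natSinv_lt (PosNum q0).
  exists N => n /hN /= {}hN; rewrite ger0_norm//.
  have : n.+1%:R^-1 * n1 t <= Num.min 1 eps.
    move: hN; rewrite ltr_pdivlMr ?ltr_wpDr// => /ltW; apply: le_trans.
    by rewrite ler_wpM2l ?invr_ge0// lerDr.
  have v0 : 0 <= n.+1%:R^-1 * n1 t by rewrite mulr_ge0 ?invr_ge0.
  rewrite le_min => /andP[v1 ve].
  by rewrite /h ge_min expr2 (le_trans (ler_piMl v0 v1))// orbT.
have [N hN] := dominated_null mh (fun n t => h0 n t) h4 (bdd_meas_integrable mu (bdd_meas_cst 4)) hnull e0.
exists N.+1%:R^-1; first by rewrite invr_gt0.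
move=> y hy x.
have -> : fourier mu (x + y) - fourier mu x =
    cintegral mu (fun t => echar (- x) t * (echar (- y) t - 1)).
  rewrite !fourierE -cintegralB; try exact: bdd_measC_echar.
  by apply: eq_cintegral => t; rewrite opprD echarD; ring.
have bg : bdd_measC (fun t : Kd K d => echar (- x) t * (echar (- y) t - 1)).
  by apply: bdd_measCM; [|apply: bdd_measCD]; do ?[exact: bdd_measC_echar|exact: bdd_measC_cst].
rewrite -lee_fin (le_trans _ (ltW (hN N (leqnn _))))//.
apply: (@le_trans _ _ (Rintegral mu setT (fun t => sqn (echar (- x) t * (echar (- y) t - 1))))%:E).
  by rewrite lee_fin; exact: sqn_cintegral_le.
rewrite -(L2sqE mu bg); apply: ge0_le_integral => //.
- by move=> t _; rewrite lee_fin sqn_ge0.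
- by apply/measurable_EFinP/measurable_sqn/bdd_measC_measC.
- exact/measurable_EFinP.
move=> t _; rewrite lee_fin sqnM sqn_cis mul1r le_min sqn_cis_sub1_le4/=.
apply: (le_trans (sqn_cis_sub1 _)).
rewrite -[leLHS]real_normK ?num_real// ler_sqr ?nnegrE//; last first.
  by rewrite !mulr_ge0 ?invr_ge0 ?pi_ge0// sumr_ge0.
rewrite normrM ger0_norm ?mulr_ge0 ?pi_ge0// /n1 mulrCA ler_wpM2l ?mulr_ge0 ?pi_ge0//.
rewrite dotNl normrN /dot (le_trans (ler_norm_sum _ _ _))// mulr_sumr.
by apply: ler_sum => i _; rewrite normrM ler_wpM2r.
Qed.

End fourier.

(** * The self-affine identity for integrals and for the transform *)

Section self_affine.
Context {K : realType} {d : nat} (R : 'M[int]_d) (B : {fset 'cV[int]_d}).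
Variable mu : probability (Kd K d) K.
Hypothesis hmu : self_affine R B mu.

(** For empty [B] the weight is [0^-1 = 0], and the identity at [setT] would give total mass 0. *)
Lemma self_affine_card_gt0 : (0 < #|` B|)%N.
Proof.
rewrite lt0n; apply/negP => /eqP B0.
have := hmu measurableT; rewrite B0 invr0 mul0e => h.
have := @probability_setT _ _ _ mu; rewrite h => /eqP.
by rewrite eqe eq_sym oner_eq0.
Qed.

Lemma measurable_tau b : measurable_fun setT (@tau K d R b).
Proof.
apply: measurable_fun_Kd => i; under eq_fun do rewrite /tau mxE.
apply: measurable_sum => j; apply: measurable_funM => //.
under eq_fun do rewrite mxE; apply: measurable_funD => //.
exact: measurable_coord.
Qed.

(** The hypothesis says that [mu] agrees on measurable sets with the scaled sum of its pushforwards
    under the maps [tau R b]; integrate against that measure. *)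
Lemma ge0_integral_self_affine (f : Kd K d -> \bar K) :
  measurable_fun setT f -> (forall x, (0 <= f x)%E) ->
  (\int[mu]_x f x = (#|` B|%:R^-1)%:E *
     \sum_(b <- enum_fset B) \int[mu]_x f (tau R b x))%E.
Proof.
move=> mf f0.
pose nu b : {measure set (Kd K d) -> \bar K} :=
  measure_function_pushforward__canonical__measure_function_Measure mu (measurable_tau b).
pose nus := msum (fun n => nu B`_n) #|` B|.
have N0 : 0 <= (#|` B|%:R^-1 : K) by rewrite invr_ge0.
rewrite (eq_measure_integral (mscale (NngNum N0) nus)).
  rewrite ge0_integral_mscale//= ge0_integral_measure_sum//.
  congr (_ * _)%E; rewrite (big_nth 0) big_mkord; apply: eq_bigr => i _.
  by rewrite ge0_integral_pushforward //; exact: measurable_tau.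
move=> A mA _; apply: (eq_trans (hmu mA)).
by rewrite /mscale /= /nus /msum (big_nth 0) big_mkord.
Qed.

Lemma Rintegral_self_affine (h : Kd K d -> K) : bdd_meas h ->
  Rintegral mu setT h =
  #|` B|%:R^-1 * \sum_(b <- enum_fset B) Rintegral mu setT (fun x => h (tau R b x)).
Proof.
move=> bh; have [mh [M hM]] := bh.
have N0 : (#|` B|%:R : K) != 0 by rewrite pnatr_eq0 -lt0n self_affine_card_gt0.
(* Adding the bound [M] makes the integrand nonnegative; averaging over [B] returns the constant
   [M], which cancels. *)
have bhM : bdd_meas (fun x => h x + M) by exact: bdd_measD bh (bdd_meas_cst M).
have bt (g : Kd K d -> K) b : bdd_meas g -> bdd_meas (fun x => g (tau R b x)).
  move=> [mg [M' hM']]; split; last by exists M'.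
  exact: measurableT_comp mg (measurable_tau b).
have pos x : 0 <= h x + M.
  by have := hM x; rewrite ler_norml => /andP[+ _]; lra.
have RM b : Rintegral mu setT (fun x => h (tau R b x) + M) =
    Rintegral mu setT (fun x => h (tau R b x)) + M.
  rewrite RintegralD//; first by rewrite Rintegral_prob_cst.
    exact/bdd_meas_integrable/bt.
  exact/bdd_meas_integrable/bdd_meas_cst.
apply: (addIr M).
have <- : Rintegral mu setT (fun x => h x + M) = Rintegral mu setT h + M.
  rewrite RintegralD//; first by rewrite Rintegral_prob_cst.
    exact/bdd_meas_integrable.
  exact/bdd_meas_integrable/bdd_meas_cst.
rewrite /Rintegral ge0_integral_self_affine//; last first.
  by apply/(measurable_EFinP setT (fun x => h x + M)%R); exact: bhM.1.
have -> : (\sum_(b <- enum_fset B) \int[mu]_x (h (tau R b x) + M)%:E =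
    (\sum_(b <- enum_fset B) (Rintegral mu setT (fun x => h (tau R b x)) + M))%:E)%E.
  rewrite -sumEFin; apply: eq_bigr => b _.
  by rewrite -RM /Rintegral fineK//; apply: integrable_fin_num => //;
  exact: bdd_meas_integrable (bt _ b bhM).
rewrite -EFinM /= big_split /= mulrDr; congr (_ + _).
by rewrite big_const_seq count_predT iter_addr_0 -[M *+ _]mulr_natl mulKf.
Qed.

Lemma cintegral_self_affine (f : Kd K d -> K[i]) : bdd_measC f ->
  cintegral mu f =
  (#|` B|%:R^-1)%:C * \sum_(b <- enum_fset B) cintegral mu (fun x => f (tau R b x)).
Proof.
move=> [bR bI]; rewrite {1}/cintegral !Rintegral_self_affine//.
have -> : \sum_(b <- enum_fset B) cintegral mu (fun x => f (tau R b x)) =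
  (\sum_(b <- enum_fset B) Rintegral mu setT (fun x => complex.Re (f (tau R b x)))) +i*
  (\sum_(b <- enum_fset B) Rintegral mu setT (fun x => complex.Im (f (tau R b x)))).
  elim: (enum_fset B) => [|b s IH]; first by rewrite !big_nil.
  by rewrite !big_cons IH.
by simpc.
Qed.

(** The function m of the overview. *)
Definition mask (xi : 'cV[K]_d) : K[i] := (#|` B|%:R^-1)%:C *
  \sum_(b <- enum_fset B) echar (- (invT K R *m xi)) (intmx K b).

Lemma fourier_mask xi : fourier mu xi = mask xi * fourier mu (invT K R *m xi).
Proof.
rewrite !fourierE cintegral_self_affine; last exact: bdd_measC_echar.
rewrite /mask -mulrA; congr (_ * _); rewrite mulr_suml; apply: eq_bigr => b _.
rewrite -cintegralM; last exact: bdd_measC_echar.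
apply: eq_cintegral => x; rewrite mulrC /echar -cisD -mulrDr -dotDr; congr (cis (_ * _)).
by rewrite -mulmxN dot_mulmx trmxK.
Qed.

End self_affine.

(** For a square matrix the one-sided relation [H H^* = 1] also gives [H^* H = 1]; this is its
    entrywise conjugate. *)
Lemma unitarymx_adjK (C : numClosedFieldType) m n (H : 'M[C]_(m, n)) :
  m = n -> H \is unitarymx -> H^T *m map_mx Num.conj H = 1%:M.
Proof.
move=> mn; subst n => /unitarymxP/mulmx1C h.
have := congr1 (map_mx (Num.conj : C -> C)) h.
have HK : map_mx Num.conj (map_mx Num.conj H^T) = H^T.
  by apply/matrixP => i j; rewrite !mxE conjCK.
by rewrite map_mxM map_mx1 HK.
Qed.

Lemma sum_sqn_unitarymx (K : realType) m n (H : 'M[K[i]]_(m, n)) (u : 'cV[K[i]]_n) :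
  m = n -> H \is unitarymx ->
  \sum_l sqn (\sum_b (H l b)^* * u b 0) = \sum_b sqn (u b 0).
Proof.
move=> mn uH; apply: (@complexI K).
pose v := map_mx Num.conj H *m u.
have vE l : v l 0 = \sum_b (H l b)^* * u b 0.
  by rewrite mxE; apply: eq_bigr => b _; rewrite mxE.
have E p (w : 'cV[K[i]]_p) : (\sum_i sqn (w i 0))%:C = ((map_mx Num.conj w)^T *m w) 0 0.
  rewrite raddf_sum mxE; apply: eq_bigr => i _.
  by rewrite !mxE mulrC mul_conj_sqn.
have -> : \sum_l sqn (\sum_b (H l b)^* * u b 0) = \sum_l sqn (v l 0).
  by apply: eq_bigr => l _; rewrite vE.
have HK : map_mx Num.conj (map_mx Num.conj H) = H.
  by apply/matrixP => i j; rewrite !mxE conjCK.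
rewrite !E /v map_mxM HK.
by rewrite trmx_mul mulmxA -(mulmxA _ H^T) unitarymx_adjK// mulmx1.
Qed.

(** * Periodicity of the mask and the Hadamard identity *)

Section mask.
Context {K : realType} {d : nat} (R : 'M[int]_d) (B L : {fset 'cV[int]_d}).
Hypothesis hRBL : hadamard_triple K R B L.
Hypothesis B0 : (0 < #|` B|)%N.

Let hR : expansive K R. Proof. by case: hRBL. Qed.

Lemma mask_period (xi : 'cV[K]_d) (k : 'cV[int]_d) :
  mask R B (xi + intmx K (R^T *m k)) = mask R B xi.
Proof.
rewrite /mask mulmxDr invT_mul//; congr (_ * _); apply: eq_bigr => b _.
by rewrite opprD echarD -intmxN /echar cis_2pi_dot_int mulr1.
Qed.

(** The values [mask (xi + l)] are [N^(-1/2)] times the image, under the conjugate Hadamard matrix,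
    of the vector [u] of unimodular entries. That matrix is an isometry and [u] has square norm
    [N]. *)
Lemma sum_sqn_mask (xi : 'cV[K]_d) :
  \sum_(l <- enum_fset L) sqn (mask R B (xi + intmx K l)) = 1.
Proof.
have [_ BL uH] := hRBL.
have N0 : (0 : K) < #|` B|%:R by rewrite ltr0n.
set s : K := Num.sqrt #|` B|%:R.
have s0 : 0 < s by rewrite sqrtr_gt0.
pose u : 'cV[K[i]]_#|` B| := \col_b echar (- (invT K R *m xi)) (intmx K B`_b).
have E l : mask R B (xi + intmx K L`_(l : 'I_#|` L|)) =
    (s^-1)%:C * \sum_b (hadamard_mx K R B L l b)^* * u b 0.
  rewrite /mask (big_nth 0) big_mkord mulr_sumr mulr_sumr; apply: eq_bigr => b _.
  rewrite !mxE rmorphM /= mulrA mulrA.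
  have -> : ((s^-1)%:C)^* = (s^-1)%:C by exact: conjc_real.
  have -> : (s^-1)%:C * (s^-1)%:C = (#|` B|%:R^-1)%:C :> K[i].
    by rewrite -rmorphM -invfM -expr2 sqr_sqrtr// ltW.
  rewrite -mulrA; congr (_ * _).
  rewrite mulmxDr opprD addrC echarD; congr (_ * _).
  rewrite echarN /echar; congr ((cis (_ * _))^*).
  by rewrite dot_mulmx /invT trmxK dotC.
rewrite (big_nth 0) big_mkord.
under eq_bigr do rewrite E sqnM.
rewrite -mulr_sumr sum_sqn_unitarymx//.
under eq_bigr do rewrite mxE sqn_cis.
rewrite sumr_const card_ord /sqn /= expr0n addr0 exprVn sqr_sqrtr ?ltW//.
by rewrite -[_ *+ _]mulr_natr mul1r mulVf// gt_eqF.
Qed.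

End mask.

Lemma eventually_all (T : eqType) (s : seq T) (P : T -> nat -> Prop) :
  (forall x, x \in s -> exists N, forall n, (N <= n)%N -> P x n) ->
  exists N, forall n, (N <= n)%N -> forall x, x \in s -> P x n.
Proof.
elim: s => [|x s IH] h; first by exists 0%N.
have [N hN] := h x (mem_head _ _).
have [M hM] := IH (fun y ys => h y (mem_behead (s := x :: s) ys)).
exists (maxn N M) => n; rewrite geq_max => /andP[Nn Mn] y.
rewrite inE => /orP[/eqP ->|ys]; [exact: hN|exact: hM].
Qed.

(** * Finite-level Parseval sets and their nested construction *)

Section tiling.
Context {K : realType} {d : nat} (R : 'M[int]_d) (B L : {fset 'cV[int]_d}).
Variable mu : probability (Kd K d) K.
Hypothesis hRBL : hadamard_triple K R B L.
Hypothesis hmu : self_affine R B mu.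
Implicit Types (xi x y : 'cV[K]_d) (k l g : 'cV[int]_d) (s t : seq 'cV[int]_d).

Let hR : expansive K R. Proof. by case: hRBL. Qed.
Let B0 : (0 < #|` B|)%N. Proof. exact: self_affine_card_gt0 hmu. Qed.

Local Notation S n := (iter n (mulmx (invT K R))).
Local Notation T n := (iter n (mulmx R^T)).
Local Notation F := (fourier mu).

Lemma iter_invT_small x (e : K) : 0 < e ->
  exists N, forall n, (N <= n)%N -> forall i, `|S n x i 0| <= e.
Proof.
move=> e0; have [N hN] := @eventually_all _ (enum 'I_d)
  (fun i n => `|S n x i 0| <= e) (fun i _ => null_seq_iter_invT x i hR e0).
by exists N => n /hN h i; apply: h; rewrite mem_enum.
Qed.

Lemma iter_invT_int n k : S n (intmx K (T n k)) = intmx K k.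
Proof. by elim: n => // n IH; rewrite iterSr iterS invT_mul. Qed.

Lemma iter_add (A : 'M[K]_d) p q x :
  iter (p + q) (mulmx A) x = iter q (mulmx A) (iter p (mulmx A) x).
Proof. by rewrite addnC iterD. Qed.

Lemma iter_trmxD n k l : T n (k + l) = T n k + T n l.
Proof. by elim: n => //= n ->; rewrite mulmxDr. Qed.

Definition pmask n xi := \prod_(j < n) mask R B (S j xi).

Lemma fourier_pmask n xi : F xi = pmask n xi * F (S n xi).
Proof.
elim: n => [|n IH]; first by rewrite /pmask big_ord0 mul1r.
by rewrite /pmask big_ord_recr /= -mulrA -(fourier_mask hmu).
Qed.

Lemma pmaskD p q xi : pmask (p + q) xi = pmask p xi * pmask q (S p xi).
Proof.
rewrite /pmask big_split_ord /=; congr (_ * _); apply: eq_bigr => j _.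
by rewrite iter_add.
Qed.

Lemma pmask_period n xi k : pmask n (xi + intmx K (T n k)) = pmask n xi.
Proof.
apply: eq_bigr => -[j /= jn] _.
(* For [j < n] at least one factor T is left after S^j cancels j of the n factors, which is exactly
   what [mask_period] needs. *)
have [m ->] : exists m, n = (j + m.+1)%N by exists (n - j.+1)%N; rewrite addnS -addSn subnKC.
by rewrite iter_mulmxD iterD iter_invT_int iterS (mask_period hRBL).
Qed.

Lemma pmask0 n : pmask n 0 = 1.
Proof.
rewrite /pmask big1 // => j _; rewrite iter_mulmx0 /mask mulmx0 oppr0.
under eq_bigr do rewrite /echar dot0l mulr0 cis0.
rewrite big_const_seq count_predT iter_addr_0.
have -> : (1 *+ size (enum_fset B) : K[i]) = (#|` B|%:R)%:C by rewrite rmorph_nat.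
by rewrite -rmorphM mulVf// pnatr_eq0 -lt0n.
Qed.

(** One Parseval identity, for every [xi]. Orthogonality and absence of repetitions in [s] are not
    imposed: they follow by evaluating it at [xi = - l]. *)
Definition tight n s := forall xi, \sum_(l <- s) sqn (pmask n (xi + intmx K l)) = 1.

Lemma tight0 : tight 0 [:: 0].
Proof. by move=> xi; rewrite big_seq1 /pmask big_ord0 sqn1. Qed.

(** The product of depth [p + q] at [xi + l + T^p g] splits into the one of depth [p] at [xi + l],
    by periodicity, and the one of depth [q] at [S^p (xi + l) + g]. Summing over [g] first gives
    1. *)
Lemma tight_comp p q s t : tight p s -> tight q t ->
  tight (p + q) [seq l + T p g | l <- s, g <- t].
Proof.
move=> hs ht xi; rewrite big_allpairs_dep /= -[RHS](hs xi); apply: eq_bigr => l _.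
rewrite -[RHS]mulr1 -(ht (S p (xi + intmx K l))) mulr_sumr; apply: eq_bigr => g _.
by rewrite intmxD addrA pmaskD sqnM pmask_period iter_mulmxD iter_invT_int.
Qed.

Lemma tight_shift q t (kappa : 'cV[int]_d -> 'cV[int]_d) : tight q t ->
  tight q [seq g + T q (kappa g) | g <- t].
Proof.
move=> ht xi; rewrite big_map -[RHS](ht xi); apply: eq_bigr => g _.
by rewrite intmxD addrA pmask_period.
Qed.

(** Translating [L] by one of its elements keeps the identity, since [xi] is arbitrary, and puts 0
    into the set. *)
Lemma tight_exists q : exists t, tight q t /\ 0 \in t.
Proof.
have [l0 l0L] : exists l0, l0 \in L.
  apply/fset0Pn; by rewrite -cardfs_gt0; have [_ BL _] := hRBL; rewrite -BL.
elim: q => [|q [t [ht t0]]].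
  by exists [:: 0]; split; [exact: tight0|rewrite inE].
have h1 : tight 1 [seq l - l0 | l <- enum_fset L].
  move=> xi; rewrite big_map -[RHS](sum_sqn_mask hRBL B0 (xi - intmx K l0)).
  apply: eq_bigr => l _; rewrite /pmask big_ord1 /= intmxD intmxN.
  by rewrite addrAC addrA.
exists [seq l + T 1 g | l <- [seq l - l0 | l <- enum_fset L], g <- t].
split; first exact: (tight_comp h1 ht).
apply/allpairsP; exists (0, 0); split=> //=; last by rewrite mulmx0 addr0.
by apply/mapP; exists l0; rewrite ?subrr.
Qed.

(** At [xi = - l] one occurrence of [l] already contributes 1, so the other nonnegative terms
    vanish. [rem] deletes a single occurrence, so a repeated [l] is covered too, which [tight_uniq]
    exploits. *)
Lemma tight_rem n s l g : tight n s -> l \in s -> g \in rem l s ->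
  pmask n (intmx K g - intmx K l) = 0.
Proof.
move=> /(_ (- intmx K l)) hs ls gs.
move: hs; rewrite (perm_big _ (perm_to_rem ls)) big_cons /= addNr pmask0 sqn1.
rewrite -[RHS]addr0 => /addrI/eqP; rewrite psumr_eq0 => [/allP/(_ g gs)/eqP|i _].
  by rewrite addrC => /sqn_eq0.
exact: sqn_ge0.
Qed.

Lemma tight_uniq n s : tight n s -> uniq s.
Proof.
move=> hs; apply: count_mem_uniq => l; case: (boolP (l \in s)) => ls.
  have /permP/(_ (pred1 l)) -> := perm_to_rem ls.
  rewrite /= eqxx; suff /count_memPn -> : l \notin rem l s by [].
  apply/negP => lr; have := tight_rem hs ls lr; rewrite subrr pmask0 => /eqP.
  by rewrite oner_eq0.
exact/count_memPn.
Qed.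

Lemma tight_orthogonal n s l g : tight n s -> l \in s -> g \in s -> g != l ->
  F (intmx K g - intmx K l) = 0.
Proof.
move=> hs ls gs gl; rewrite (fourier_pmask n) (tight_rem hs ls) ?mul0r//.
by rewrite rem_filter ?(tight_uniq hs)// mem_filter /= gl.
Qed.

Variables (c delta : K).
Hypotheses (c0 : 0 < c) (delta0 : 0 < delta).
(** Kept apart from [hF] because at [x = 0] the integer shift has to be 0. *)
Hypothesis hF0 : forall y, (forall i, `|y i 0| <= delta) -> c <= sqn (F y).
Hypothesis hF : forall x, exists k, forall y, (forall i, `|y i 0| <= delta) ->
  c <= sqn (F (x + intmx K k + y)).

(** Only half of the margin is promised: the other half absorbs older frequencies in
    [tight_stable_step]. *)
Definition tight_stable n s := [/\ tight n s, 0 \in s &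
  forall l, l \in s -> forall y, (forall i, `|y i 0| <= delta / 2) ->
    c <= sqn (F (S n (intmx K l) + y))].

Lemma tight_stable0 : tight_stable 0 [:: 0].
Proof.
split; [exact: tight0|by rewrite inE|move=> l; rewrite inE => /eqP -> y hy].
rewrite /= intmx0 add0r; apply: hF0 => i.
by rewrite (le_trans (hy i))// ler_pdivrMr// mulr_natr mulr2n lerDl ltW.
Qed.

(** At depth [p + q] the frequency [l + T^p (g + T^q k)] rescales to [S^(p+q) l + S^q g + k]. The
    first term is at most [delta / 2] for large [q], and [k] is chosen by [hF] for the point
    [S^q g]. *)
Lemma tight_stable_step p s : tight_stable p s ->
  exists p' s', [/\ tight_stable p' s', (p < p')%N & {subset s <= s'}].
Proof.
move=> [hs s0 hsF].
have d2 : 0 < delta / 2 by rewrite divr_gt0.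
have [N hN] := @eventually_all _ s (fun l n => forall i, `|S n (intmx K l) i 0| <= delta / 2)
  (fun l _ => iter_invT_small (intmx K l) d2).
(* The strict inequality forces [q > 0], hence strict growth of the depth. *)
have [q Nq] : exists q, (N < q)%N by exists N.+1.
have [t [ht t0]] := tight_exists q.
(* Requiring [kap 0 = 0] keeps 0 in the shifted set, so every [l] of [s] survives as [l + T^p 0]. *)
have /choice[kap hkap] g : exists k, (g = 0 -> k = 0) /\
    forall y, (forall i, `|y i 0| <= delta) ->
    c <= sqn (F (S q (intmx K g) + intmx K k + y)).
  have [->|g0] := eqVneq g 0.
    exists 0; split=> // y hy.
    by rewrite intmx0 iter_mulmx0 !add0r; exact: hF0.
  have [k hk] := hF (S q (intmx K g)).
  by exists k; split=> // /eqP; rewrite (negbTE g0).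
exists (p + q)%N, [seq l + T p g | l <- s, g <- [seq g + T q (kap g) | g <- t]].
split.
- split.
  + exact: tight_comp hs (tight_shift kap ht).
  + apply/allpairsP; exists (0, 0); split=> //=.
      by apply/mapP; exists 0 => //; rewrite (hkap 0).1// iter_mulmx0 addr0.
    by rewrite iter_mulmx0 addr0.
  + move=> _ /allpairsP[[l _] /= [ls /mapP[g gt ->] ->]] y hy.
    rewrite iter_trmxD !intmxD !iter_mulmxD.
    have -> : S (p + q) (intmx K (T p g)) = S q (intmx K g).
      by rewrite iter_add iter_invT_int.
    have -> : S (p + q) (intmx K (T p (T q (kap g)))) = intmx K (kap g).
      by rewrite iter_add !iter_invT_int.
    rewrite addrAC addrC.
    apply: (hkap g).2 => i; rewrite mxE (le_trans (ler_normD _ _))// [leRHS]splitr.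
    by rewrite lerD//; apply: hN => //; exact: leq_trans (ltnW Nq) (leq_addl _ _).
- by rewrite -[X in (X < _)%N]addn0 ltn_add2l (leq_ltn_trans _ Nq).
- move=> l ls; apply/allpairsP; exists (l, 0); split=> //=.
    by apply/mapP; exists 0 => //; rewrite (hkap 0).1// iter_mulmx0 addr0.
  by rewrite iter_mulmx0 addr0.
Qed.

Lemma tight_stable_chain : exists (p : nat -> nat) (Lam : nat -> seq 'cV[int]_d),
  [/\ forall n, tight_stable (p n) (Lam n), forall n, (n <= p n)%N &
   forall m n, (m <= n)%N -> {subset Lam m <= Lam n}].
Proof.
pose X := {u : nat * seq 'cV[int]_d | tight_stable u.1 u.2}.
have /choice[f hf] (u : X) : exists v : X,
    ((sval u).1 < (sval v).1)%N /\ {subset (sval u).2 <= (sval v).2}.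
  case: u => -[p s] /= /tight_stable_step[p' [s' [h pp' ss']]].
  by exists (exist _ (p', s') h).
pose u n := iter n f (exist _ (0%N, [:: 0]) tight_stable0).
exists (fun n => (sval (u n)).1), (fun n => (sval (u n)).2); split.
- by move=> n; exact: (svalP (u n)).
- by elim=> // n IH; exact: leq_ltn_trans IH (hf (u n)).1.
- move=> m n /subnKC <-; elim: (n - m)%N => [|k IH] l lm; first by rewrite addn0.
  by rewrite addnS; apply: (hf (u (m + k)%N)).2; exact: IH.
Qed.

Lemma big_subset_uniq s t (G : 'cV[int]_d -> K) : uniq s -> uniq t ->
  {subset s <= t} ->
  \sum_(l <- t) G l = \sum_(l <- s) G l + \sum_(l <- t | l \notin s) G l.
Proof.
move=> us ut st; rewrite (bigID (mem s)) /=; congr (_ + _).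
rewrite -big_filter; apply/perm_big/uniq_perm => //; first exact: filter_uniq.
by move=> l; rewrite mem_filter; case: (boolP (l \in s)) => // /st ->.
Qed.

(** If the real part [u] satisfies [1 - u <= e / 2], then [u ^+ 2 >= 2 * u - 1 >= 1 - e]. *)
Lemma sqn_fourier_near0 (e : K) : 0 < e -> exists2 r : K, 0 < r &
  forall y, (forall i, `|y i 0| <= r) -> 1 - e <= sqn (F y).
Proof.
move=> e0; have e2 : 0 < (e / 2) ^+ 2 by rewrite exprn_gt0 ?divr_gt0.
have [r r0 hr] := fourier_unif mu e2; exists r => // y /hr/(_ 0).
rewrite add0r fourier0; case: (F y) => u v; rewrite /sqn /= subr0 => h.
have hu : (u - 1) ^+ 2 <= (e / 2) ^+ 2.
  by apply: le_trans h; rewrite lerDl sqr_ge0.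
have : 1 - u <= e / 2.
  have h0 : 0 < e / 2 by rewrite divr_gt0.
  by rewrite leNgt; apply/negP => hlt; nra.
have := sqr_ge0 v; have := sqr_ge0 u; nra.
Qed.

(* Tannery's argument. On [Lam k] the finite level mass is at most [1/c] times
   the mass of [mu], so mass missing from the supremum of the partial sums would
   keep being recovered at later levels. *)
Lemma tight_stable_complete (p : nat -> nat) (Lam : nat -> seq 'cV[int]_d) :
  (forall n, tight_stable (p n) (Lam n)) -> (forall n, (n <= p n)%N) ->
  (forall m n, (m <= n)%N -> {subset Lam m <= Lam n}) ->
  forall xi (e : K), 0 < e ->
  exists n, 1 - e < \sum_(l <- Lam n) sqn (F (xi + intmx K l)).
Proof.
move=> hL hp hsub xi e e0; apply: contrapT => /forallNP hn.
pose sig n := \sum_(l <- Lam n) sqn (F (xi + intmx K l)).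
pose a n l := sqn (pmask (p n) (xi + intmx K l)).
have a1 n : \sum_(l <- Lam n) a n l = 1 by have [h _ _] := hL n; exact: h.
have FE n l : sqn (F (xi + intmx K l)) =
    a n l * sqn (F (S (p n) (xi + intmx K l))).
  by rewrite (fourier_pmask (p n)) sqnM.
have sige n : sig n <= 1 - e by rewrite leNgt; apply/negP; exact: hn.
have hsup : has_sup (range sig).
  by split; [exists (sig 0%N); exists 0%N|exists (1 - e) => _ [n _ <-]].
(* The gain that level [k] will be shown to make over level [j]; [sig j] is taken closer than this
   to the supremum. *)
have ce : 0 < c * (e / 2) by rewrite mulr_gt0 ?divr_gt0.
have [_ [j _ <-] hj] := sup_adherent ce hsup.
have [r r0 hr] := sqn_fourier_near0 (divr_gt0 e0 (ltr0n K 2)).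
have [N1 hN1] := @eventually_all _ (Lam j)
  (fun l n => forall i, `|S n (xi + intmx K l) i 0| <= r)
  (fun l _ => iter_invT_small (xi + intmx K l) r0).
have [N2 hN2] := iter_invT_small xi (divr_gt0 delta0 (ltr0n K 2)).
pose k := maxn j (maxn N1 N2).
have jk : (j <= k)%N by rewrite leq_maxl.
have N1k : (N1 <= p k)%N by rewrite (leq_trans _ (hp k))// /k !leq_max leqnn orbT.
have N2k : (N2 <= p k)%N by rewrite (leq_trans _ (hp k))// /k !leq_max leqnn !orbT.
have uniqL n : uniq (Lam n) by have [/tight_uniq] := hL n.
have split_k G := big_subset_uniq G (uniqL j) (uniqL k) (hsub j k jk).
set X := \sum_(l <- Lam j) a k l.
have X1 : X + \sum_(l <- Lam k | l \notin Lam j) a k l = 1 by rewrite -split_k a1.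
have rest0 : 0 <= \sum_(l <- Lam k | l \notin Lam j) a k l.
  by apply: sumr_ge0 => l _; exact: sqn_ge0.
have Xle : (1 - e / 2) * X <= sig j.
  rewrite mulr_sumr /sig big_seq [leRHS]big_seq; apply: ler_sum => l lj.
  rewrite (FE k) mulrC ler_wpM2l ?sqn_ge0//; apply: hr; exact: hN1.
have X0 : 0 <= X by apply: sumr_ge0 => l _; exact: sqn_ge0.
(* Since [X <= 1], the bound [(1 - e / 2) * X <= sig j <= 1 - e] gives [X <= 1 - e / 2]. *)
have rest : e / 2 <= \sum_(l <- Lam k | l \notin Lam j) a k l.
  by have := sige j; nra.
have : sig j + c * (e / 2) <= sig k.
  rewrite /sig split_k lerD2l (le_trans (ler_wpM2l (ltW c0) rest))//.
  rewrite mulr_sumr big_seq_cond [leRHS]big_seq_cond; apply: ler_sum => l /andP[lk _].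
  rewrite (FE k) mulrC ler_wpM2l ?sqn_ge0// iter_mulmxD addrC.
  by have [_ _ h] := hL k; apply: h => // i; exact: hN2.
apply/negP; rewrite -ltNge.
have : sig k <= sup (range sig) by apply: sup_upper_bound => //; exists k.
lra.
Qed.

End tiling.

(** * Uniform lower bounds from an empty periodic zero set *)

Section nonvanishing.
Context {K : realType} {d : nat}.
Variable mu : probability (Kd K d) K.

Lemma sqn_lower (z w : K[i]) (e : K) : sqn (z - w) <= e -> sqn w / 2 - e <= sqn z.
Proof.
move=> h; have : sqn w <= 2 * sqn z + 2 * sqn (- (z - w)).
  by apply: le_trans (sqnD_le _ _); rewrite opprB addrC subrK.
by rewrite sqnN; lra.
Qed.

(* The supremum over [k] of [|fourier (x + k)|] is [Z^d]-periodic, so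
   compactness of the unit cube makes its positivity uniform. *)
Lemma periodic_zeros0_lower : periodic_zeros mu = set0 ->
  exists2 e : K, 0 < e & forall x : 'cV[K]_d, exists k, e < sqn (fourier mu (x + intmx K k)).
Proof.
move=> Z0.
have nz (x : 'cV[K]_d) : exists k, fourier mu (x + intmx K k) <> 0.
  apply: contrapT => /forallNP h.
  suff : periodic_zeros mu x by rewrite Z0.
  by move=> k; apply: contrapT; exact: h.
pose A : set 'rV[K]_d := [set v | forall i, `[0, 1]%classic (v ord0 i)].
have /compact_near_coveringP cA : compact A.
  by apply: (@rV_compact K d (fun=> `[0, 1]%classic)) => i; exact: segment_compact.
pose P (e : K) (v : 'rV[K]_d) := exists k, e < sqn (fourier mu (v^T + intmx K k)).
have : \forall e \near (0 : K)^'+, A `<=` P e.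
  apply: cA => v _; have [k hk] := nz v^T.
  set s := sqn (fourier mu (v^T + intmx K k)).
  have s0 : 0 < s.
    by rewrite lt_neqAle sqn_ge0 andbT eq_sym; apply/eqP => /sqn_eq0.
  (* With error [s / 8], [sqn_lower] leaves [s / 2 - s / 8], which exceeds [s / 4]. *)
  have [delta delta0 hdelta] := fourier_unif mu (divr_gt0 s0 (ltr0n K 8)).
  exists (ball v delta, [set e | e < s / 4]).
    split; first exact: nbhsx_ballx.
    by apply: nbhs_right_lt; rewrite divr_gt0.
  move=> [w e] /= [[_ vw] es]; exists k; apply: lt_le_trans es _.
  have hw i : `|(w^T - v^T) i 0| <= delta.
    by rewrite !mxE distrC ltW//; exact: vw.
  have := sqn_lower (hdelta _ hw (v^T + intmx K k)).
  rewrite -/s; have -> : v^T + intmx K k + (w^T - v^T) = w^T + intmx K k.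
    by rewrite addrC addrA subrK.
  lra.
move=> h; have [e [eP e0]] : exists e : K, A `<=` P e /\ 0 < e.
  apply: (@filter_ex _ (0 : K)^'+); apply: filterI h _; exact: nbhs_right_gt.
exists e => // x.
pose k0 : 'cV[int]_d := \col_i (- Num.floor (x i 0)).
have [|k] := eP (x + intmx K k0)^T.
  move=> i; rewrite /= !mxE in_itv /= rmorphN /= subr_ge0 floor_le /=.
  by rewrite lerBlDr addrC -[1]/(1%:~R) -intrD ltW// floorD1_gt.
by rewrite trmxK => hk; exists (k0 + k); rewrite intmxD addrA.
Qed.

Lemma fourier_stable_lower : periodic_zeros mu = set0 ->
  exists c delta : K, [/\ 0 < c, 0 < delta,
    forall y : 'cV[K]_d, (forall i, `|y i 0| <= delta) -> c <= sqn (fourier mu y) &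
    forall x : 'cV[K]_d, exists k, forall y : 'cV[K]_d, (forall i, `|y i 0| <= delta) ->
      c <= sqn (fourier mu (x + intmx K k + y))].
Proof.
move=> /periodic_zeros0_lower[e e0 he].
have e4 : 0 < e / 4 by rewrite divr_gt0.
have [delta delta0 hdelta] := fourier_unif mu e4.
(* For shifted points [e / 2 - e / 4 = e / 4]. Near 0 the bound is [1 / 2 - e / 4], which suffices
   because [e < 1]: some value above [e] is at most 1. *)
exists (e / 4), delta; split=> // [y hy|x].
  have := sqn_lower (hdelta y hy 0); rewrite add0r fourier0 sqn1.
  have [k] := he 0; have := sqn_fourier_le1 mu (0 + intmx K k); lra.
have [k hk] := he x; exists k => y hy.
by have := sqn_lower (hdelta y hy (x + intmx K k)); lra.
Qed.

End nonvanishing.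

(** * Density of the exponentials in L2 *)

Section closed_span.
Context {K : realType} {d : nat}.
Variable mu : probability (Kd K d) K.
Implicit Types (f g : Kd K d -> K[i]) (J : set 'cV[K]_d).

(** Frequencies may repeat in the list, so that a sum is a concatenation and a product with an
    exponential is a map; [trigpolyE] collects equal frequencies. *)
Definition trigpoly (s : seq (K[i] * 'cV[K]_d)) (x : Kd K d) : K[i] :=
  \sum_(p <- s) p.1 * echar p.2 x.

Definition closed_span J f := measC f /\ forall e : K, 0 < e ->
  exists s, (forall p, p \in s -> J p.2) /\
    (L2sq mu (fun x => f x - trigpoly s x)%R < e%:E)%E.

Lemma bdd_measC_trigpoly s : bdd_measC (trigpoly s).
Proof.
by apply: bdd_measC_sum => p; apply: bdd_measCM; [exact: bdd_measC_cst|exact: bdd_measC_echar].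
Qed.

Lemma measC_trigpoly s : measC (trigpoly s).
Proof. exact/bdd_measC_measC/bdd_measC_trigpoly. Qed.

Lemma L2sq_eq f g : f =1 g -> L2sq mu f = L2sq mu g.
Proof. by move=> /funext ->. Qed.

Lemma L2sq_0 : L2sq mu (fun=> 0) = 0%E.
Proof. by rewrite L2sqE ?sqn0 ?Rintegral_prob_cst//; exact: bdd_measC_cst. Qed.

Lemma L2sq_lt_half f g (e : K) : measC f -> measC g ->
  (L2sq mu f < (e / 4)%:E)%E -> (L2sq mu g < (e / 4)%:E)%E ->
  (L2sq mu (fun x => f x + g x)%R < e%:E)%E.
Proof.
move=> mf mg hf hg; apply: le_lt_trans (L2sqD mu mf mg) _.
have -> : e%:E = (2%:E * (e / 4)%:E + 2%:E * (e / 4)%:E)%E.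
  by rewrite -!EFinM -EFinD; congr (_%:E); field.
by apply: lteD; rewrite lte_pmul2l.
Qed.

Lemma closed_span_closed J f : measC f ->
  (forall e : K, 0 < e -> exists g, closed_span J g /\
     (L2sq mu (fun x => f x - g x)%R < e%:E)%E) -> closed_span J f.
Proof.
move=> mf h; split=> // e e0; have e4 : 0 < e / 4 by rewrite divr_gt0.
have [g [[mg /(_ _ e4)[s [hs hg]]] hfg]] := h _ e4.
exists s; split=> //.
rewrite (@L2sq_eq _ (fun x => (f x - g x) + (g x - trigpoly s x))%R); last first.
  by move=> x; rewrite addrA subrK.
by apply: L2sq_lt_half => //; apply: measCB => //; exact: measC_trigpoly.
Qed.

Lemma closed_span_trigpoly J s : (forall p, p \in s -> J p.2) ->
  closed_span J (trigpoly s).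
Proof.
move=> hs; split; first exact: measC_trigpoly.
move=> e e0; exists s; split=> //.
by rewrite (@L2sq_eq _ (fun=> 0)) ?L2sq_0 ?lte_fin// => x; rewrite subrr.
Qed.

Lemma closed_span_echar J a : J a -> closed_span J (fun x => echar a x).
Proof.
move=> Ja; have -> : (fun x : Kd K d => echar a x) = trigpoly [:: (1, a)].
  by apply/funext => x; rewrite /trigpoly big_seq1 mul1r.
by apply: closed_span_trigpoly => p; rewrite inE => /eqP ->.
Qed.

Lemma closed_spanD J f g : closed_span J f -> closed_span J g ->
  closed_span J (fun x => f x + g x).
Proof.
move=> [mf hf] [mg hg]; split; first exact: measCD.
move=> e e0; have e4 : 0 < e / 4 by rewrite divr_gt0.
have [s [hs fs]] := hf _ e4; have [t [ht gt]] := hg _ e4.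
exists (s ++ t); split=> [p|].
  by rewrite mem_cat => /orP[/hs|/ht].
rewrite (@L2sq_eq _ (fun x => (f x - trigpoly s x) + (g x - trigpoly t x))%R).
  by apply: L2sq_lt_half => //; apply: measCB => //; exact: measC_trigpoly.
by move=> x; rewrite /trigpoly big_cat opprD addrACA.
Qed.

Lemma closed_spanZ J (a : K[i]) f : closed_span J f -> closed_span J (fun x => a * f x).
Proof.
move=> [mf hf]; split; first by apply: measCM => //; exact/bdd_measC_measC/bdd_measC_cst.
move=> e e0; have a0 := sqn_ge0 a.
have e1 : 0 < e / (sqn a + 1) by rewrite divr_gt0// ltr_wpDl.
have [s [hs fs]] := hf _ e1.
exists [seq (a * p.1, p.2) | p <- s]; split=> [_ /mapP[p /hs ? ->]//|].
rewrite (@L2sq_eq _ (fun x => a * (f x - trigpoly s x))%R); last first.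
  move=> x; rewrite /trigpoly big_map mulrBr mulr_sumr; congr (_ - _).
  by apply: eq_bigr => p _; rewrite mulrA.
rewrite L2sqZ; last by apply: measCB => //; exact: measC_trigpoly.
apply: (@le_lt_trans _ _ ((sqn a)%:E * (e / (sqn a + 1))%:E)%E).
  by rewrite lee_wpmul2l ?lee_fin// ltW.
rewrite -EFinM lte_fin mulrCA -[ltRHS]mulr1 ltr_pM2l// ltr_pdivrMr ?ltr_wpDl//.
by rewrite mul1r ltrDl.
Qed.

Lemma closed_spanB J f g : closed_span J f -> closed_span J g ->
  closed_span J (fun x => f x - g x).
Proof.
move=> hf hg; have -> : (fun x => f x - g x) = (fun x => f x + (-1) * g x).
  by apply/funext => x; rewrite mulN1r.
by apply: closed_spanD => //; exact: closed_spanZ.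
Qed.

Lemma closed_span_sum J (I : Type) (s : seq I) (f : I -> Kd K d -> K[i]) :
  (forall i, closed_span J (f i)) -> closed_span J (fun x => \sum_(i <- s) f i x).
Proof.
move=> hf; elim: s => [|i s IH].
  under eq_fun do rewrite big_nil; have -> : (fun=> 0) = trigpoly [::].
    by apply/funext => x; rewrite /trigpoly big_nil.
  exact: closed_span_trigpoly.
by under eq_fun do rewrite big_cons; exact: closed_spanD.
Qed.

(** Reduces completeness of a set [J] of frequencies to approximating single exponentials. *)
Lemma closed_span_trans J J' f : (forall a, J' a -> closed_span J (fun x => echar a x)) ->
  closed_span J' f -> closed_span J f.
Proof.
move=> h [mf hf]; apply: closed_span_closed => // e /hf[s [hs fs]].
exists (trigpoly s); split=> // {fs}.
elim: s hs => [|p s IH] hs; first exact: closed_span_trigpoly.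
have -> : trigpoly (p :: s) = (fun x => p.1 * echar p.2 x + trigpoly s x).
  by apply/funext => x; rewrite /trigpoly big_cons.
apply: closed_spanD; last by apply: IH => q qs; apply: hs; rewrite inE qs orbT.
by apply: closed_spanZ; apply: h; apply: hs; rewrite mem_head.
Qed.

Lemma closed_span_fin J f : closed_span J f -> (L2sq mu f < +oo)%E.
Proof.
move=> [mf /(_ 1 ltr01)[s [_ fs]]].
rewrite (@L2sq_eq _ (fun x => (f x - trigpoly s x) + trigpoly s x)%R); last first.
  by move=> x; rewrite subrK.
apply: le_lt_trans (L2sqD _ _ _) _; [|exact: measC_trigpoly|].
  by apply: measCB => //; exact: measC_trigpoly.
rewrite (L2sqE mu (bdd_measC_trigpoly s)) -EFinM lte_add_pinfty ?ltry// lte_mul_pinfty//.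
exact: lt_trans fs (ltry _).
Qed.

(* Multipliers of the closed span of all exponentials: an algebra stable under
   bounded pointwise limits. *)
Definition multiplier f := bdd_measC f /\
  forall g, closed_span setT g -> closed_span setT (fun x => f x * g x).

Lemma multiplier_cst (a : K[i]) : multiplier (fun=> a).
Proof. by split=> [|g]; [exact: bdd_measC_cst|exact: closed_spanZ]. Qed.

Lemma multiplierD f g : multiplier f -> multiplier g -> multiplier (fun x => f x + g x).
Proof.
move=> [bf hf] [bg hg]; split=> [|h hh]; first exact: bdd_measCD.
under eq_fun do rewrite mulrDl.
by apply: closed_spanD; [exact: hf|exact: hg].
Qed.

Lemma multiplierM f g : multiplier f -> multiplier g -> multiplier (fun x => f x * g x).
Proof.
move=> [bf hf] [bg hg]; split=> [|h hh]; first exact: bdd_measCM.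
by under eq_fun do rewrite -mulrA; apply: hf; exact: hg.
Qed.

Lemma multiplierB f g : multiplier f -> multiplier g -> multiplier (fun x => f x - g x).
Proof.
move=> hf hg; under eq_fun do rewrite -mulN1r.
by apply: multiplierD => //; apply: multiplierM => //; exact: multiplier_cst.
Qed.

(** Multiplication by a unimodular exponential preserves [L2sq] and translates frequencies. *)
Lemma multiplier_echar a : multiplier (fun x => echar a x).
Proof.
split=> [|g [mg hg]]; first exact: bdd_measC_echar.
split=> [|e /hg[s [_ hs]]].
  by apply: measCM => //; exact/bdd_measC_measC/bdd_measC_echar.
exists [seq (p.1, a + p.2) | p <- s]; split=> //.
rewrite /L2sq; under eq_integral => x _.
  have -> : echar a x * g x - trigpoly [seq (p.1, a + p.2) | p <- s] x =
      echar a x * (g x - trigpoly s x).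
    rewrite mulrBr /trigpoly big_map mulr_sumr; congr (_ - _).
    by apply: eq_bigr => p _; rewrite echarD mulrCA.
  rewrite sqnM sqn_cis mul1r; over.
exact: hs.
Qed.

(** Dominated convergence applied to [|f - fn n|^2 |g|^2], at most [4 M |g|^2], which is integrable
    because members of the closed span have finite norm. *)
Lemma multiplier_lim (f : Kd K d -> K[i]) (fn : nat -> Kd K d -> K[i]) (M : K) :
  bdd_measC f -> (forall n, multiplier (fn n)) ->
  (forall x, sqn (f x) <= M) -> (forall n x, sqn (fn n x) <= M) ->
  (forall x, null_seq (fun n => sqn (f x - fn n x))) -> multiplier f.
Proof.
move=> bf hfn fM fnM hlim; split=> // g hg; have [mg _] := hg.
have mcfn n : measC (fn n) by exact/bdd_measC_measC/(hfn n).1.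
apply: closed_span_closed; first by apply: measCM => //; exact: bdd_measC_measC.
move=> e e0.
have ig : mu.-integrable setT (EFin \o (fun x => (4 * M) * sqn (g x))).
  have [fin] := closed_span_fin hg.
  apply/integrableP; split.
    apply/measurable_EFinP; apply: measurable_funM => //; exact: measurable_sqn.
  under eq_integral => x _ do rewrite /= normrM (ger0_norm (sqn_ge0 _)) EFinM.
  rewrite ge0_integralZl_EFin//; last 2 first.
  - by move=> x _; rewrite lee_fin sqn_ge0.
  - exact/measurable_EFinP/measurable_sqn.
  by rewrite lte_mul_pinfty// lee_fin.
have bound n x : sqn (f x * g x - fn n x * g x) <= 4 * M * sqn (g x).
  rewrite -mulrBl sqnM ler_wpM2r ?sqn_ge0//.
  rewrite (le_trans (sqnD_le _ _))// sqnN.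
  by have := fM x; have := fnM n x; lra.
have mh n : measurable_fun setT (fun x => sqn (f x * g x - fn n x * g x)).
  by apply: measurable_sqn; apply: measCB; apply: measCM => //; exact: bdd_measC_measC.
have lim x : null_seq (fun n => sqn (f x * g x - fn n x * g x)).
  move=> eps eps0; have g1 : 0 < sqn (g x) + 1 by rewrite ltr_wpDl ?sqn_ge0.
  have [N hN] := hlim x _ (divr_gt0 eps0 g1); exists N => n /hN.
  rewrite -mulrBl sqnM !ger0_norm ?mulr_ge0 ?sqn_ge0// ler_pdivlMr//.
  by apply: le_trans; rewrite ler_wpM2l ?sqn_ge0// lerDl.
have [N hN] := dominated_null mh (fun n x => sqn_ge0 _) bound ig lim e0.
by exists (fun x => fn N x * g x); split; [exact: (hfn N).2|exact: hN].
Qed.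

Lemma multiplier_closed_span f : multiplier f -> closed_span setT f.
Proof.
move=> [_ hf]; have -> : f = (fun x => f x * 1) by apply/funext => x; rewrite mulr1.
apply: hf; have -> : (fun=> 1) = (fun x : Kd K d => echar 0 x).
  by apply/funext => x; rewrite /echar dot0l mulr0 cis0.
exact: closed_span_echar.
Qed.

Lemma multiplier_sin a (b : K) : multiplier (fun x => (sin (2 * pi * dot a x + b))%:C).
Proof.
(* [w] is [1 / (2 i)], from Euler's formula for the sine. *)
pose w : K[i] := 0 +i* (- 2^-1).
have -> : (fun x : Kd K d => (sin (2 * pi * dot a x + b))%:C) =
  (fun x => w * (cis b * echar a x) - w * (cis (- b) * echar (- a) x)).
  apply/funext => x; rewrite -mulrBr /echar dotNl mulrN -!cisD -opprD addrC.
  rewrite /cis cosN sinN /w; simpc; congr (_ +i* _).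
  by move: (sin _) => t; field.
have mul z c : multiplier (fun x => w * (cis c * echar z x)).
  apply: multiplierM (multiplier_cst w) _.
  exact: multiplierM (multiplier_cst _) (multiplier_echar z).
exact: multiplierB (mul a b) (mul (- a) (- b)).
Qed.

(* The iterates of this polynomial converge on [-1, 1] to the sign function,
   which turns sines, and then half-spaces, into multipliers. *)
Definition smoothstep (t : K) : K := (3 * t - t ^+ 3) / 2.

(** Both inequalities are visible in the factorizations [1 - smoothstep t = (1 - t)^2 (2 + t) / 2]
    and [1 + smoothstep t = (1 + t)^2 (2 - t) / 2]. *)
Lemma smoothstep_bound (t : K) : `|t| <= 1 -> `|smoothstep t| <= 1.
Proof.
rewrite /smoothstep !ler_norml => /andP[h1 h2]; apply/andP.
have h3 : 0 <= (1 - t) ^+ 2 * (2 + t) by rewrite mulr_ge0 ?sqr_ge0//; lra.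
have h4 : 0 <= (1 + t) ^+ 2 * (2 - t) by rewrite mulr_ge0 ?sqr_ge0//; lra.
split.
  have -> : (3 * t - t ^+ 3) / 2 = (1 + t) ^+ 2 * (2 - t) / 2 - 1 by field.
  lra.
have -> : (3 * t - t ^+ 3) / 2 = 1 - (1 - t) ^+ 2 * (2 + t) / 2 by field.
lra.
Qed.

Lemma iter_smoothstep_bound n (t : K) : `|t| <= 1 -> `|iter n smoothstep t| <= 1.
Proof. by move=> t1; elim: n => //= n; exact: smoothstep_bound. Qed.

Lemma iter_smoothstepN n (t : K) : iter n smoothstep (- t) = - iter n smoothstep t.
Proof. by elim: n => //= n ->; rewrite /smoothstep; field. Qed.

Lemma iter_smoothstep_sg (t : K) : `|t| <= 1 ->
  null_seq (fun n => Num.sg t - iter n smoothstep t).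
Proof.
have pos (s : K) : 0 < s -> s <= 1 -> null_seq (fun n => 1 - iter n smoothstep s).
  move=> s0 s1.
  have it n : s <= iter n smoothstep s <= 1.
    elim: n => [|n /andP[h1 h2]]; first by rewrite lexx.
    have s1' : `|s| <= 1 by rewrite ger0_norm// ltW.
    have := iter_smoothstep_bound n.+1 s1'; rewrite ler_norml => /andP[_ ->]; rewrite andbT /= (le_trans h1)//.
    move: (iter _ _ _) h1 h2 => r h1 h2.
    have -> : smoothstep r = r + r * (1 - r) * (1 + r) / 2 by rewrite /smoothstep; field.
    by rewrite lerDl divr_ge0// !mulr_ge0//; lra.
  (* The iterates [r] stay above [s], so the distance to 1 shrinks by
     [(1 - r) (2 + r) / 2 <= 1 - s / 2]. *)
  apply: (null_seq_contraction (r := 1 - s / 2) (e := fun=> 0)).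
  - lra.
  - lra.
  - by move=> n; rewrite subr_ge0; case/andP: (it n).
  - move=> n /=; case/andP: (it n); move: (iter _ _ _) => r h1 h2.
    have -> : 1 - smoothstep r = (1 - r) * ((1 - r) * (2 + r) / 2).
      by rewrite /smoothstep; field.
    rewrite addr0 mulrC ler_wpM2r ?subr_ge0//; nra.
  - by move=> e e0; exists 0%N => n _; rewrite normr0 ltW.
move=> t1 e e0; case: (ltrgt0P t) => t0.
- by rewrite gtr0_sg//; apply: pos => //; rewrite (le_trans (ler_norm _)).
- have [||N hN] := pos (- t) _ _ e e0; first by rewrite oppr_gt0.
    by rewrite (le_trans _ t1)// -normrN ler_norm.
  exists N => n /hN; rewrite iter_smoothstepN ltr0_sg//.
  have -> : -1 - iter n smoothstep t = - (1 - - iter n smoothstep t) by ring.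
  by rewrite normrN.
- exists 0%N => n _; rewrite t0 sgr0 sub0r normrN.
  have -> : iter n smoothstep 0 = 0.
    by elim: n => //= n ->; rewrite /smoothstep expr0n /= mulr0 subr0 mul0r.
  by rewrite normr0 ltW.
Qed.

Lemma multiplier_smoothstep n (u : Kd K d -> K) : multiplier (fun x => (u x)%:C) ->
  multiplier (fun x => (iter n smoothstep (u x))%:C).
Proof.
elim: n => // n IH /IH hu /=; set v := (fun x => iter n smoothstep (u x)).
have -> : (fun x => (smoothstep (iter n smoothstep (u x)))%:C) =
   (fun x => (2^-1)%:C * (3%:C * (v x)%:C - (v x)%:C * ((v x)%:C * (v x)%:C))).
  apply/funext => x; rewrite -!rmorphM -rmorphB -rmorphM; congr (_%:C).
  by rewrite /smoothstep -/(v x); field.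
apply: multiplierM; first exact: multiplier_cst.
apply: multiplierB; apply: multiplierM => //; first exact: multiplier_cst.
exact: multiplierM.
Qed.

Lemma sqn_real (t : K) : sqn t%:C = t ^+ 2.
Proof. by rewrite /sqn /= expr0n addr0. Qed.

Lemma null_seq_sqr (u : nat -> K) : null_seq u -> null_seq (fun n => u n ^+ 2).
Proof.
move=> hu e e0; have [N hN] := hu (Num.min 1 e) ltac:(by rewrite lt_min ltr01).
exists N => n /hN; rewrite le_min => /andP[h1 he].
by rewrite normrX expr2 (le_trans _ he)// ler_piMl.
Qed.

Lemma bdd_measC_real (u : Kd K d -> K) : bdd_meas u -> bdd_measC (fun x => (u x)%:C).
Proof. by move=> bu; split=> //; exact: bdd_meas_cst. Qed.

Lemma multiplier_lim_real (u : Kd K d -> K) (un : nat -> Kd K d -> K) :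
  measurable_fun setT u -> (forall n, multiplier (fun x => (un n x)%:C)) ->
  (forall x, `|u x| <= 1) -> (forall n x, `|un n x| <= 1) ->
  (forall x, null_seq (fun n => u x - un n x)) -> multiplier (fun x => (u x)%:C).
Proof.
move=> mu_ hun u1 un1 hlim; apply: (multiplier_lim (M := 1) _ hun).
- by apply: bdd_measC_real; split=> //; exists 1.
- by move=> x; rewrite sqn_real -[_ ^+ 2]real_normK ?num_real// expr_le1.
- by move=> n x; rewrite sqn_real -[_ ^+ 2]real_normK ?num_real// expr_le1.
- move=> x; have := null_seq_sqr (hlim x).
  by under [X in _ -> null_seq X]eq_fun do rewrite -rmorphB sqn_real.
Qed.

Lemma measurable_sg (u : Kd K d -> K) : measurable_fun setT u ->
  measurable_fun setT (fun x => Num.sg (u x)).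
Proof.
move=> mu_; apply: (measurableT_comp _ mu_).
apply: nondecreasing_measurable => // x y xy.
by case: (sgrP x) => hx; case: (sgrP y) => hy; lra.
Qed.

Lemma multiplier_sg (u : Kd K d -> K) : multiplier (fun x => (u x)%:C) ->
  (forall x, `|u x| <= 1) -> multiplier (fun x => (Num.sg (u x))%:C).
Proof.
move=> hu u1; have [[[mu1 _] _] _] := hu.
apply: (multiplier_lim_real (un := fun n x => iter n smoothstep (u x))).
- exact: measurable_sg.
- by move=> n; exact: multiplier_smoothstep.
- by move=> x; rewrite normr_sg; case: (_ != 0) => /=; rewrite ?ler01.
- by move=> n x; exact: iter_smoothstep_bound.
- by move=> x; exact: iter_smoothstep_sg.
Qed.

Lemma sg_sin_eventually (z : K) :
  exists N, forall n, (N <= n)%N -> Num.sg (sin (z / n.+1%:R)) = Num.sg z.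
Proof.
have pos (y : K) : 0 < y ->
    exists N, forall n, (N <= n)%N -> Num.sg (sin (y / n.+1%:R)) = Num.sg y.
  move=> y0; exists (Num.trunc y) => n hn.
  rewrite !gtr0_sg// sin2_gt0// divr_gt0//= ltr_pdivrMr//.
  rewrite (lt_le_trans (truncnS_gt y))//.
  have : ((Num.trunc y).+1%:R : K) <= n.+1%:R by rewrite ler_nat.
  have : 0 <= (n.+1%:R : K) by [].
  lra.
case: (ltrgt0P z) => [/pos//|z0|->].
  have [|N hN] := pos (- z); first by rewrite oppr_gt0.
  by exists N => n /hN; rewrite mulNr sinN !sgrN => /oppr_inj.
by exists 0%N => n _; rewrite mul0r sin0.
Qed.

(** A single sine has the sign of its argument only near 0. Stretching the period by [n + 1] moves
    each fixed point into that range eventually. *)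
Lemma multiplier_sg_coord i (a : K) : multiplier (fun x => (Num.sg (x i 0 - a))%:C).
Proof.
pose un n (x : Kd K d) : K := Num.sg (sin ((x i 0 - a) / n.+1%:R)).
apply: (multiplier_lim_real (un := un)).
- apply: measurable_sg; apply: measurable_funB => //; exact: measurable_coord.
- move=> n; apply: multiplier_sg => [|x]; last exact: sin_max.
  pose xi : 'cV[K]_d := (2 * pi * n.+1%:R)^-1 *: delta_mx i 0.
  have -> : (fun x : Kd K d => (sin ((x i 0 - a) / n.+1%:R))%:C) =
    (fun x => (sin (2 * pi * dot xi x + - a / n.+1%:R))%:C).
    apply/funext => x; congr (sin _)%:C; rewrite mulrBl mulNr; congr (_ - _).
    rewrite /dot (bigD1 i)//= big1 => [|j ji]; last first.
      by rewrite !mxE (negbTE ji) mulr0 mul0r.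
    rewrite !mxE !eqxx addr0 mulr1.
    have p0 : (pi : K) != 0 by rewrite gt_eqF// pi_gt0.
    have : (n.+1%:R : K) != 0 by rewrite pnatr_eq0.
    by move: (n.+1%:R) (pi) p0 => N p p0 N0; field; rewrite N0 p0.
  exact: multiplier_sin.
- by move=> x; rewrite normr_sg; case: (_ != 0) => /=; rewrite ?ler01.
- by move=> n x; rewrite normr_sg; case: (_ != 0) => /=; rewrite ?ler01.
- move=> x e e0; have [N hN] := sg_sin_eventually (x i 0 - a).
  by exists N => n /hN; rewrite /un => ->; rewrite subrr normr0 ltW.
Qed.

Definition multiplier_set (A : set (Kd K d)) :=
  measurable A /\ multiplier (fun x => (\1_A x)%:C).

Lemma multiplier_setC A : multiplier_set A -> multiplier_set (~` A).
Proof.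
move=> [mA hA]; split; first exact: measurableC.
have -> : (fun x => (\1_(~` A) x)%:C) = (fun x => 1 - (\1_A x)%:C) :> (Kd K d -> K[i]).
  apply/funext => x; transitivity ((1 - \1_A x : K)%:C); last by rewrite rmorphB.
  by rewrite !indicE in_setC; case: (x \in A); rewrite ?subrr ?subr0.
by apply: multiplierB => //; exact: multiplier_cst.
Qed.

Lemma multiplier_setI A A' : multiplier_set A -> multiplier_set A' ->
  multiplier_set (A `&` A').
Proof.
move=> [mA hA] [mA' hA']; split; first exact: measurableI.
have -> : (fun x => (\1_(A `&` A') x)%:C) = (fun x => (\1_A x)%:C * (\1_A' x)%:C) :> (Kd K d -> K[i]).
  apply/funext => x; rewrite !indicE in_setI -rmorphM; congr (_%:C).
  by case: (x \in A); rewrite ?mul1r ?mul0r.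
exact: multiplierM.
Qed.

Lemma multiplier_set0 : multiplier_set set0.
Proof.
split=> //; have -> : (fun x => (\1_set0 x)%:C) = (fun=> 0) :> (Kd K d -> K[i]).
  by apply/funext => x; rewrite indicE in_set0.
exact: multiplier_cst.
Qed.

Lemma multiplier_set_bigcup (F : nat -> set (Kd K d)) :
  (forall n, multiplier_set (F n)) -> multiplier_set (\bigcup_n F n).
Proof.
move=> hF; have mU : measurable (\bigcup_n F n).
  by apply: bigcup_measurable => n _; exact: (hF n).1.
(* Finite unions come from complements and intersections; their indicators converge pointwise to
   that of the whole union. *)
split=> //; pose Un n := \big[setU/set0]_(k < n) F k.
have hU n : multiplier_set (Un n).
  rewrite /Un; elim: n => [|n IH]; first by rewrite big_ord0; exact: multiplier_set0.
  rewrite big_ord_recr /= -[X in multiplier_set X]setCK setCU.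
  by apply/multiplier_setC/multiplier_setI; exact: multiplier_setC.
have ind1 (A : set (Kd K d)) x : `|\1_A x : K| <= 1.
  by rewrite indicE; case: (x \in A); rewrite ?normr1 ?normr0 ?ler01.
apply: (multiplier_lim_real (un := fun n => \1_(Un n))) => //.
- by move=> n; exact: (hU n).2.
- move=> x e e0.
  have [[n _ Fx]|nx] := pselect ((\bigcup_n F n) x).
    exists n.+1 => m nm.
    have Ux : (\bigcup_n F n) x by exists n.
    have Umx : Un m x by rewrite /Un -bigcup_mkord; exists n.
    by rewrite !indicE !mem_set// subrr normr0 ltW.
  exists 0%N => m _.
  have nUm : ~ Un m x by rewrite /Un -bigcup_mkord => -[k _ Fk]; apply: nx; exists k.
  by rewrite !indicE !memNset// subrr normr0 ltW.
Qed.

Lemma multiplier_set_halfspace i (a : K) : multiplier_set [set x | a < x i 0].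
Proof.
have m : measurable ([set x | a < x i 0] : set (Kd K d)).
  have := @measurable_coord K d i measurableT _ (measurable_itv `]a, +oo[).
  rewrite setTI; congr measurable.
  by apply/seteqP; split=> x /=; rewrite in_itv /= andbT.
split=> //; pose s (x : Kd K d) : K := Num.sg (x i 0 - a).
(* On the values -1, 0, 1 of [s], the polynomial [(s^2 + s) / 2] is 0, 0, 1: the indicator of the
   strict half-space. *)
have -> : (fun x => (\1_[set x : Kd K d | a < x i 0] x)%:C) =
    (fun x => (2^-1)%:C * ((s x)%:C * (s x)%:C + (s x)%:C)) :> (Kd K d -> K[i]).
  apply/funext => x; rewrite -!rmorphM -rmorphD -rmorphM; congr (_%:C).
  rewrite indicE /s; case: (ltrgt0P (x i 0 - a)) => h.
  - have ax : a < x i 0 by rewrite -subr_gt0.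
    by rewrite mem_set// gtr0_sg// mul1r mulVf.
  - rewrite memNset /=; first by rewrite ltr0_sg// mulrNN mul1r subrr mulr0.
    by apply/negP; rewrite -leNgt -subr_le0 ltW.
  - rewrite memNset /=; first by rewrite h sgr0 mul0r addr0 mulr0.
    by apply/negP; rewrite -leNgt -subr_le0 h.
apply: multiplierM; first exact: multiplier_cst.
have hs := multiplier_sg_coord i a.
apply: multiplierD => //; exact: multiplierM.
Qed.

Lemma multiplier_set_measurable (A : set (Kd K d)) : measurable A -> multiplier_set A.
Proof.
have sa : sigma_algebra setT multiplier_set.
  split; [exact: multiplier_set0| |exact: multiplier_set_bigcup].
  by move=> X hX; rewrite setTD; exact: multiplier_setC.
apply: smallest_sub => //.
exact: sigma_algebra_open sa multiplier_set_halfspace.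
Qed.

Lemma closed_span_nnsfun (f : {nnsfun Kd K d >-> K}) :
  closed_span setT (fun x => (f x)%:C).
Proof.
have -> : (fun x => (f x)%:C) = (fun x => \sum_(y <- fset_set (range f))
    y%:C * (\1_(f @^-1` [set y]) x)%:C).
  apply/funext => x; rewrite fimfunE fsbig_finite// rmorph_sum.
  by apply: eq_bigr => y _; rewrite rmorphM.
apply: closed_span_sum => y; apply: closed_spanZ; apply: multiplier_closed_span.
by apply: (multiplier_set_measurable _).2.
Qed.

Lemma closed_span_ge0 (u : Kd K d -> K) : measurable_fun setT u ->
  (forall x, 0 <= u x) -> (L2sq mu (fun x => (u x)%:C) < +oo)%E ->
  closed_span setT (fun x => (u x)%:C).
Proof.
move=> mu_ u0 fin.
have mcfu : measC (fun x => (u x)%:C) by split=> //; exact: measurable_cst.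
have muE : measurable_fun setT (EFin \o u) by exact/measurable_EFinP.
have [g [ndg gcvg]] := approximation measurableT muE (fun x _ => u0 x).
have mg n : measC (fun x => (g n x)%:C) by split=> //; exact: measurable_cst.
apply: closed_span_closed => // e e0.
have ig : mu.-integrable setT (EFin \o (fun x => sqn (u x)%:C)).
  apply/integrableP; split; first exact/measurable_EFinP/measurable_sqn.
  by under eq_integral => x _ do rewrite /= (ger0_norm (sqn_ge0 _)).
have gu n x : 0 <= g n x <= u x.
  rewrite fun_ge0 /=.
  have cx : g k x @[k --> \oo] --> u x by exact: fine_cvg (gcvg x I).
  rewrite -[leRHS](cvg_lim _ cx)//; apply: nondecreasing_cvgn_le; last exact: cvgP cx.
  by move=> a b ab; have /lefP := ndg _ _ ab; exact.
have lim x : null_seq (fun n => sqn ((u x)%:C - (g n x)%:C)).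
  have : null_seq (fun n => u x - g n x).
    move=> eps eps0; have cx : g k x @[k --> \oo] --> u x by exact: fine_cvg (gcvg x I).
    move/cvgrPdist_le : cx => /(_ _ eps0)[N _ hN].
    by exists N.
  move=> /null_seq_sqr.
  by under [X in _ -> null_seq X]eq_fun do rewrite -rmorphB sqn_real.
have mh n : measurable_fun setT (fun x => sqn ((u x)%:C - (g n x)%:C)).
  by apply: measurable_sqn; exact: measCB.
have bound n x : sqn ((u x)%:C - (g n x)%:C) <= sqn (u x)%:C.
  rewrite -rmorphB !sqn_real ler_sqr ?nnegrE ?subr_ge0 ?u0//; have /andP[h1 h2] := gu n x => //.
  by rewrite lerBlDr lerDl.
have [N hN] := dominated_null mh (fun n x => sqn_ge0 _) bound ig lim e0.
exists (fun x => (g N x)%:C); split; [exact: closed_span_nnsfun|exact: hN].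
Qed.

Lemma closed_span_L2 f : inL2 mu f -> closed_span setT f.
Proof.
move=> [mR mI /L2norm_fin fin].
have real (u : Kd K d -> K) : measurable_fun setT u ->
    (forall x, u x ^+ 2 <= sqn (f x)) -> closed_span setT (fun x => (u x)%:C).
  move=> mu_ hu.
  have part (v : Kd K d -> K) : measurable_fun setT v -> (forall x, 0 <= v x) ->
      (forall x, v x <= `|u x|) -> closed_span setT (fun x => (v x)%:C).
    move=> mv v0 vu; apply: closed_span_ge0 => //; apply: le_lt_trans fin.
    apply: ge0_le_integral => //.
    - by move=> x _; rewrite lee_fin sqn_ge0.
    - by apply/measurable_EFinP/measurable_sqn; split=> //; exact: measurable_cst.
    - exact/measurable_EFinP/measurable_sqn.
    - move=> x _; rewrite lee_fin sqn_real (le_trans _ (hu x))//.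
      by rewrite -[leRHS]real_normK ?num_real// ler_sqr// nnegrE.
  have -> : (fun x => (u x)%:C) = (fun x => (Num.max (u x) 0)%:C - (Num.max (- u x) 0)%:C).
    apply/funext => x; rewrite -rmorphB; congr (_%:C).
    have [h|/ltW h] := lerP 0 (u x).
      by rewrite ?(max_l h) max_r ?oppr_le0// subr0.
    by rewrite ?(max_r h) max_l ?oppr_ge0// sub0r opprK.
  apply: closed_spanB; apply: part.
  - exact: measurable_maxr.
  - by move=> x; rewrite le_max lexx orbT.
  - by move=> x; rewrite ge_max ler_norm normr_ge0.
  - by apply: measurable_maxr => //; exact: measurableT_comp.
  - by move=> x; rewrite le_max lexx orbT.
  - by move=> x; rewrite ge_max normr_ge0 andbT -normrN ler_norm.
have -> : f = (fun x => (complex.Re (f x))%:C + 'i%C * (complex.Im (f x))%:C).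
  by apply/funext => x; rewrite -complexE.
apply: closed_spanD; last apply: closed_spanZ; apply: real => // x.
  by rewrite /sqn lerDl sqr_ge0.
by rewrite /sqn lerDr sqr_ge0.
Qed.

End closed_span.

(** * Orthogonality and approximation of single exponentials *)

Section bessel.
Context {K : realType} {d : nat}.
Variable mu : probability (Kd K d) K.
Implicit Types (f g : Kd K d -> K[i]).

Lemma inner_pythagoras f g : bdd_measC f -> bdd_measC g -> inner mu f g = 0 ->
  Rintegral mu setT (fun x => sqn (f x + g x)) =
  Rintegral mu setT (fun x => sqn (f x)) + Rintegral mu setT (fun x => sqn (g x)).
Proof.
move=> bf bg; rewrite /inner /cintegral => -[fg _].
have bfg : bdd_meas (fun x => complex.Re (f x * (g x)^*)).
  exact: (bdd_measCM bf (bdd_measCJ bg)).1.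
rewrite (@eq_Rintegral _ _ _ _ _
  (fun x => (sqn (f x) + sqn (g x)) + 2 * complex.Re (f x * (g x)^*))); last first.
  by move=> x _; case: (f x) => a b; case: (g x) => p q; rewrite /sqn /=; ring.
have b2 : bdd_meas (fun x => 2 * complex.Re (f x * (g x)^*)).
  by apply: bdd_measM => //; exact: bdd_meas_cst.
rewrite RintegralD//; last 2 first.
- by apply/bdd_meas_integrable/bdd_measD; exact: bdd_meas_sqn.
- exact: bdd_meas_integrable.
rewrite RintegralZl//; last exact: bdd_meas_integrable.
rewrite fg mulr0 addr0 RintegralD//; exact/bdd_meas_integrable/bdd_meas_sqn.
Qed.

Lemma inner_trigpolyr f s : bdd_measC f ->
  inner mu f (trigpoly s) = \sum_(p <- s) p.1^* * inner mu f (fun x => echar p.2 x).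
Proof.
move=> bf; have b p : bdd_measC (fun x => f x * (echar p x)^*).
  by apply: bdd_measCM => //; apply: bdd_measCJ; exact: bdd_measC_echar.
under eq_bigr do rewrite -cintegralM//.
rewrite -cintegral_sum; last by move=> p; apply: bdd_measCM => //; exact: bdd_measC_cst.
apply: eq_cintegral => x; rewrite rmorph_sum mulr_sumr; apply: eq_bigr => p _.
by rewrite rmorphM mulrCA.
Qed.

Lemma innerBl f g h : bdd_measC f -> bdd_measC g -> bdd_measC h ->
  inner mu (fun x => f x - g x) h = inner mu f h - inner mu g h.
Proof.
move=> bf bg bh; rewrite -cintegralB; do ?by apply: bdd_measCM => //; exact: bdd_measCJ.
by apply: eq_cintegral => x; rewrite mulrBl.
Qed.

Lemma inner_conj f g : bdd_measC f -> bdd_measC g -> inner mu g f = (inner mu f g)^*.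
Proof.
move=> bf bg; rewrite -cintegralJ; last by apply: bdd_measCM => //; exact: bdd_measCJ.
by apply: eq_cintegral => x; rewrite rmorphM /= conjCK mulrC.
Qed.

Lemma Rintegral_sqn_echar a : Rintegral mu setT (fun x : Kd K d => sqn (echar a x)) = 1.
Proof.
by under eq_Rintegral do rewrite sqn_cis; exact: Rintegral_prob_cst.
Qed.

Lemma inL2_echar a : inL2 mu (fun x : Kd K d => echar a x).
Proof.
have [[mR _] [mI _]] := @bdd_measC_echar K d a; split=> //.
by apply/L2norm_fin; rewrite L2sqE ?ltry//; exact: bdd_measC_echar.
Qed.

Lemma trigpolyE s (x : Kd K d) : trigpoly s x =
  \sum_(j <- undup [seq p.2 | p <- s]) (\sum_(p <- s | p.2 == j) p.1) * echar j x.
Proof.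
under [RHS]eq_bigr do rewrite mulr_suml.
rewrite (exchange_big_dep xpredT)//= /trigpoly big_seq [RHS]big_seq.
apply: eq_bigr => p ps; rewrite (eq_bigl (fun j => j == p.2)); last first.
  by move=> j; rewrite eq_sym.
rewrite -big_filter filter_pred1_uniq ?undup_uniq ?big_seq1// mem_undup.
by apply/mapP; exists p.
Qed.

Lemma closed_span_L2norm J f : closed_span mu J f -> forall eps : K, 0 < eps ->
  exists (s : seq 'cV[K]_d) (c : 'cV[K]_d -> K[i]), (forall j, j \in s -> J j) /\
    (L2norm mu (fun x => f x - \sum_(j <- s) c j * echar j x)%R < eps%:E)%E.
Proof.
move=> [_ hf] eps eps0; have [s [hs fs]] := hf (eps ^+ 2) (exprn_gt0 _ eps0).
exists (undup [seq p.2 | p <- s]), (fun j => \sum_(p <- s | p.2 == j) p.1); split.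
  by move=> j; rewrite mem_undup => /mapP[p /hs ? ->].
apply/L2norm_lt => //; move: fs; congr (_ < _)%E; apply: L2sq_eq => x.
by rewrite trigpolyE.
Qed.

(* The residual of the orthogonal projection of [echar a] has square norm
   [1 - \sum_l |<echar a, echar l>|^2]. *)
Lemma closed_span_parseval (J : set 'cV[K]_d) (a : 'cV[K]_d) :
  (forall e : K, 0 < e -> exists s : seq 'cV[K]_d,
    [/\ uniq s, forall l, l \in s -> J l,
     forall l g : 'cV[K]_d, l \in s -> g \in s -> g != l -> fourier mu (g - l) = 0 &
     1 - e < \sum_(l <- s) sqn (fourier mu (l - a))]) ->
  closed_span mu J (fun x => echar a x).
Proof.
move=> h; split; first exact/bdd_measC_measC/bdd_measC_echar.
move=> e /h[s [us sJ orth hs]].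
pose c l := fourier mu (l - a); pose t := [seq (c l, l) | l <- s].
exists t; split=> [_ /mapP[l /sJ ? ->]//|].
have bt := bdd_measC_trigpoly t; have ba := bdd_measC_echar a.
pose r (x : Kd K d) : K[i] := echar a x - trigpoly t x.
have br : bdd_measC r by apply: bdd_measCD => //; exact: bdd_measCN.
have tl l : l \in s -> inner mu (trigpoly t) (fun x => echar l x) = c l.
  move=> ls; rewrite inner_conj//; last exact: bdd_measC_echar.
  rewrite inner_trigpolyr; last exact: bdd_measC_echar.
  rewrite big_map (bigD1_seq l)//= inner_echar subrr fourier0 mulr1 big_seq_cond big1.
    by rewrite addr0 conjCK.
  by move=> g /andP[gs gl]; rewrite inner_echar orth// mulr0.
have r0 : inner mu r (trigpoly t) = 0.
  rewrite inner_trigpolyr// big_map big_seq big1// => l ls /=.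
  rewrite innerBl//; last exact: bdd_measC_echar.
  by rewrite tl// inner_echar subrr mulr0.
have tt : Rintegral mu setT (fun x => sqn (trigpoly t x)) = \sum_(l <- s) sqn (c l).
  apply: (@complexI K); rewrite -innerE// inner_trigpolyr// big_map rmorph_sum.
  rewrite big_seq [RHS]big_seq; apply: eq_bigr => l ls /=.
  by rewrite tl// mulrC mul_conj_sqn.
have := inner_pythagoras br bt r0.
rewrite tt; under eq_Rintegral do rewrite /r subrK.
rewrite Rintegral_sqn_echar => E.
rewrite L2sqE// lte_fin -/r; lra.
Qed.

End bessel.

(** * The two implications *)

Section spectrum.
Context {K : realType} {d : nat} (R : 'M[int]_d) (B L : {fset 'cV[int]_d}).
Variable mu : probability (Kd K d) K.
Hypothesis hRBL : hadamard_triple K R B L.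
Hypothesis hmu : self_affine R B mu.

Lemma periodic_zeros0_spectrum : periodic_zeros mu = set0 ->
  exists Lambda : set 'cV[K]_d, is_spectrum mu Lambda /\ Lambda `<=` Zd K d.
Proof.
move=> /fourier_stable_lower[c [delta [c0 delta0 hF0 hF]]].
have [p [Lam [hL hp hsub]]] := tight_stable_chain hRBL hmu delta0 hF0 hF.
pose Lambda : set 'cV[K]_d := [set x | exists n k, k \in Lam n /\ x = intmx K k].
exists Lambda; split; last by move=> x [n [k [_ ->]]]; exists k.
have Lambda_img : Lambda `<=` range (fun k : 'cV[int]_d => intmx K k).
  by move=> x [n [k [_ ->]]]; exists k.
have orth k l n : k \in Lam n -> l \in Lam n -> l != k ->
    fourier mu (intmx K l - intmx K k) = 0.
  by move=> kn ln; have [ht _ _] := hL n; exact: (tight_orthogonal hmu ht).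
split.
  apply: sub_countable (subset_card_le Lambda_img) _.
  apply: sub_countable (card_image_le _ _) _; exact: countableP.
split.
- by move=> j _; exact: inL2_echar.
- move=> _ _ [m [k [km ->]]] [n [l [ln ->]]]; rewrite inner_echar.
  case: eqVneq => [->|kl]; first by rewrite subrr fourier0.
  (* Nestedness puts two frequencies of different levels into one set. *)
  apply: (orth k l (maxn m n)).
  + by apply: hsub km; rewrite leq_maxl.
  + by apply: hsub ln; rewrite leq_maxr.
  + by apply: contra_neq kl => ->.
move=> f /(closed_span_L2 (mu := mu)) hf; apply: closed_span_L2norm.
apply: closed_span_trans hf => a _; apply: closed_span_parseval => e e0.
(* The point [- a] is used because the coefficient of [echar a] at the frequency [l] is
   [fourier mu (l - a)], up to conjugation. *)
have [n hn] := tight_stable_complete hRBL hmu c0 delta0 hL hp hsub (- a) e0.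
exists [seq intmx K k | k <- Lam n]; split.
- rewrite map_inj_uniq; last exact: intmx_inj.
  by have [ht _ _] := hL n; exact: (tight_uniq hmu ht).
- by move=> _ /mapP[k kn ->]; exists n, k.
- move=> _ _ /mapP[k kn ->] /mapP[l ln ->] lk; apply: (orth k l n) => //.
  by apply: contra_neq lk => ->.
- by rewrite big_map; under eq_bigr do rewrite addrC.
Qed.

(** By Pythagoras, an exponential orthogonal to the whole family is at squared distance at least 1
    from every finite combination, so approximation within 1 already fails. *)
Lemma spectrum_periodic_zeros0 (Lambda : set 'cV[K]_d) :
  is_spectrum mu Lambda -> Lambda `<=` Zd K d -> periodic_zeros mu = set0.
Proof.
move=> [_ [_ _ dense]] LZ; rewrite -subset0 => xi hxi.
have [s [c [sL]]] := dense _ (inL2_echar mu (- xi)) 1 ltr01.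
pose t := [seq (- c j, j) | j <- s].
rewrite L2norm_lt// expr1n (@L2sq_eq _ _ _ _ (fun x => echar (- xi) x + trigpoly t x)); last first.
  move=> x; rewrite /trigpoly big_map -sumrN; congr (_ + _).
  by apply: eq_bigr => j _; rewrite mulNr.
have b := bdd_measC_echar (- xi); have bt := bdd_measC_trigpoly t.
rewrite L2sqE; last exact: bdd_measCD.
rewrite inner_pythagoras//; last first.
  rewrite inner_trigpolyr// big_map big_seq big1// => j js /=.
  have [k ->] := LZ _ (sL _ js).
  by rewrite inner_echar opprK addrC hxi mulr0.
rewrite Rintegral_sqn_echar lte_fin ltNge lerDl => /negP; apply.
by apply: Rintegral_ge0 => x _; exact: sqn_ge0.
Qed.

End spectrum.

Theorem theorem1p7 (K : realType) (d : nat) (R : 'M[int]_d)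
    (B L : {fset 'cV[int]_d}) (mu : probability (Kd K d) K)
    (hRBL : hadamard_triple K R B L) (hmu : self_affine R B mu) :
  (periodic_zeros mu = set0 <->
    exists Lambda : set 'cV[K]_d,
      is_spectrum mu Lambda /\ Lambda `<=` Zd K d) /\
  (periodic_zeros mu = set0 -> spectral_measure mu).
Proof.
have h := periodic_zeros0_spectrum hRBL hmu.
split; last by move=> /h[Lambda [hL _]]; exists Lambda.
split=> // -[Lambda [hL LZ]]; exact: spectrum_periodic_zeros0 hL LZ.
Qed.
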